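(* Let $T$ be a linear operator generated by an endomorphism $\tau$ of $(\Omega,\beta,\mu)$ and let $S_ng=\frac1n\sum_{i=0}^{n-1}T^ig$. The following hold. 1. If $f\in L_p(\Omega,X)$, $p>1$, and $\sup_{n_2}\|E(f|F_{n_2})\|_X\in L_1$, then $$\Big\|\sup_{n_1,n_2}\|S_{n_1}(E(f|F_{n_2}))\|_X\Big\|_p\le\left(\frac p{p-1}\right)^2\|f\|_p.$$ 2. Let $m\ge0$ be an integer. If $f\in L(\Omega,X)[\log^+L(\Omega,X)]^{m+2}$, then $$\sup_{n_1,n_2}\|S_{n_1}(E(f|F_{n_2}))\|_X\in L[\log^+L]^m.$$
   Context: $X$ is a reflexive Banach space with norm $\|\cdot\|_X$, and $(\Omega,\beta,\mu)$ is a finite measure space. For $1\le p<\infty$, $L_p(\Omega,X)$ is the Banach space of (strongly) measurable functions $f:\Omega\to X$ with finite norm $\|f\|_p=\left(\int_\Omega\|f(\omega)\|_X^p\,d\mu\right)^{1/p}$; $L_p$ denotes this space for $X=\mathbb R$. For $f$ with values in $X$, $\|f\|_X$ denotes the function $\omega\mapsto\|f(\omega)\|_X$. $E(f|F)$ is the conditional expectation of $f$ with respect to a $\sigma$-subalgebra $F\subset\beta$. $(F_n)_{n\ge1}$ is a monotone (increasing or decreasing) sequence of $\sigma$-subalgebras of $\beta$, with $F_n\uparrow F_\infty$ or $F_n\downarrow F_\infty$. A linear operator $T:L_1(\Omega,X)\to L_1(\Omega,X)$ is generated by an endomorphism $\tau$ (a measure-preserving transformation of $(\Omega,\beta,\mu)$)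 if $Tf=f\circ\tau$. $L(\Omega,X)[\log^+L(\Omega,X)]^m$ is the class of measurable functions $f:\Omega\to X$ with $\int_\Omega\|f\|_X[\log\max(1,\|f\|_X)]^m\,d\mu<\infty$ (for $m=0$ this is $L_1(\Omega,X)$); it is written $L[\log^+L]^m$ when $X=\mathbb R$. *)

(* Defs.v *)
From HB Require Import structures.
From mathcomp Require Import all_boot all_order all_algebra.
From mathcomp Require Import all_classical all_reals all_analysis.
Set Implicit Arguments.
Unset Strict Implicit.
Unset Printing Implicit Defensive.
Import Order.TTheory GRing.Theory Num.Theory.
Import numFieldNormedType.Exports.
Local Open Scope classical_set_scope.
Local Open Scope ring_scope.

Definition dual_space (R : realType) (X : normedModType R) : set (X -> R^o) :=
  [set phi | linear phi /\ continuous phi].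

Definition dual_norm (R : realType) (X : normedModType R) (phi : X -> R^o) : R :=
  sup [set `|phi x| | x in [set x : X | `|x| <= 1]].

(* Elements of the bidual are represented by functions on all of [X -> R^o];
   only their values on [dual_space X] are relevant. *)
Definition bidual_space (R : realType) (X : normedModType R) :
    set ((X -> R^o) -> R) :=
  [set Phi |
    (forall (a : R) (phi psi : X -> R^o), dual_space phi -> dual_space psi ->
      Phi (fun x => a * phi x + psi x) = a * Phi phi + Phi psi) /\
    (exists C : R, forall phi : X -> R^o, dual_space phi ->
      `|Phi phi| <= C * dual_norm phi)].

Definition reflexive_space (R : realType) (X : normedModType R) : Prop :=
  forall Phi : (X -> R^o) -> R, bidual_space Phi ->
    exists x : X, forall phi : X -> R^o, dual_space phi -> Phi phi = phi x.

(* Measurability is relative to an explicit family [G] of sets, so that the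
   same notions serve for the sigma-algebra of the space and for its
   sub-sigma-algebras. *)
Definition simple_fun (T : Type) (R : realType) (X : normedModType R)
    (G : set (set T)) (s : T -> X) : Prop :=
  finite_set (range s) /\ forall x, G (s @^-1` [set x]).

Definition strongly_measurable (T : Type) (R : realType) (X : normedModType R)
    (G : set (set T)) (f : T -> X) : Prop :=
  exists2 s : nat -> T -> X, (forall n, simple_fun G (s n)) &
    forall w, s ^~ w @ \oo --> f w.

Definition simple_integral d (T : measurableType d) (R : realType)
    (X : normedModType R) (mu : {finite_measure set T -> \bar R})
    (A : set T) (s : T -> X) : X :=
  \sum_(x \in range s) fine (mu (A `&` s @^-1` [set x])) *: x.

Definition is_bochner_integral d (T : measurableType d) (R : realType)
    (X : normedModType R) (mu : {finite_measure set T -> \bar R})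
    (A : set T) (f : T -> X) (v : X) : Prop :=
  exists s : nat -> T -> X,
    [/\ forall n, simple_fun measurable (s n),
        (\int[mu]_(w in A) (`|f w - s n w|)%:E)%E @[n --> \oo] --> 0%E &
        simple_integral mu A (s n) @[n --> \oo] --> v].

Definition norm_fun (T : Type) (R : realType) (X : normedModType R)
    (f : T -> X) : T -> \bar R := fun w => (`|f w|)%:E.

Definition Lp_space d (T : measurableType d) (R : realType)
    (X : normedModType R) (mu : {finite_measure set T -> \bar R}) (p : R) :
    set (T -> X) :=
  [set f | strongly_measurable measurable f /\
           ('N[mu]_p%:E [norm_fun f] < +oo)%E].

Definition LlogL_space d (T : measurableType d) (R : realType)
    (X : normedModType R) (mu : {finite_measure set T -> \bar R}) (m : nat) :
    set (T -> X) :=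
  [set f | strongly_measurable measurable f /\
    (\int[mu]_w (`|f w| * ln (Num.max 1 `|f w|) ^+ m)%:E < +oo)%E].

Definition sub_sigma_algebra_of d (T : measurableType d) (F : set (set T)) :=
  sigma_algebra [set: T] F /\ F `<=` measurable.

(* [g] is a version of E(f|F); the integrals over the sets of [F] agree as
   Bochner integrals, which exist since [f] and [g] are in L_1. *)
Definition is_cond_exp d (T : measurableType d) (R : realType)
    (X : normedModType R) (mu : {finite_measure set T -> \bar R})
    (F : set (set T)) (f g : T -> X) : Prop :=
  [/\ strongly_measurable F g,
      Lp_space mu 1 g &
      forall A, F A ->
        exists2 v, is_bochner_integral mu A f v & is_bochner_integral mu A g v].

Definition monotone_sigma_algebras (T : Type) (F : nat -> set (set T))
    (Finf : set (set T)) : Prop :=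
  ((forall m n, (m <= n)%N -> F m `<=` F n) /\ Finf = <<s \bigcup_n F n >>) \/
  ((forall m n, (m <= n)%N -> F n `<=` F m) /\ Finf = \bigcap_n F n).

Definition measure_preserving d (T : measurableType d) (R : realType)
    (mu : {finite_measure set T -> \bar R}) (tau : T -> T) : Prop :=
  measurable_fun [set: T] tau /\
  forall A, measurable A -> mu (tau @^-1` A) = mu A.

Definition generated_operator (T Y : Type) (tau : T -> T) :
  (T -> Y) -> (T -> Y) := fun f => f \o tau.

Definition ergodic_average (T : Type) (R : realType) (X : normedModType R)
    (U : (T -> X) -> (T -> X)) (n : nat) (g : T -> X) : T -> X :=
  fun w => n%:R^-1 *: \sum_(0 <= i < n) iter i U g w.

(* The sequence [g] is indexed from 0, the averages from 1. *)
Definition sup_averages (T : Type) (R : realType) (X : normedModType R)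
    (U : (T -> X) -> (T -> X)) (g : nat -> T -> X) : T -> \bar R :=
  fun w => ereal_sup
    [set (`|ergodic_average U n1 (g n2) w|)%:E
      | n1 in [set n | (0 < n)%N] & n2 in [set: nat]].

(* Main.v *)
Require Import Defs.
From mathcomp Require Import all_boot all_order all_algebra.
From mathcomp Require Import finmap.
From mathcomp Require Import all_classical all_reals all_analysis.
From mathcomp Require Import measurable_realfun ring lra.
Import Order.TTheory GRing.Theory Num.Theory.
Import numFieldNormedType.Exports.
Local Open Scope classical_set_scope.
Local Open Scope ring_scope.

(** The double supremum is dominated by two successive maximal functions.  Let [G]
    be the supremum over [n] of the norms of [E(f | F n)].  Since the operator is
    composition with [tau], the norm of an ergodic average of [E(f | F n)] is at
    most the ergodic average of [G], so the double supremum is at most the maximal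
    function [H] of the ergodic averages of [G].

    Both steps obey the same weak-type inequality, [weak_maximal]: for [l > 0], [l]
    times the measure of the set where the maximal function exceeds [l] is at most
    the integral over that set of the original function.  For [G] this is Doob's
    argument ([maximal_submartingale_in], [doob_maximal]); the vector-valued
    conditional expectations enter it only through [cond_exp_contraction], by which
    the integral of the norm of [E(f | F n)] over a set of [F n] is at most that of
    the norm of [f].  For [H] it is Hopf's maximal ergodic theorem
    ([maximal_ergodic], [ergodic_maximal]).

    Integrating the weak-type inequality against a density in [l]
    ([layer_cake_le]) yields strong inequalities: in Lp with the factor
    [p / (p - 1)] ([strong_maximal_Lp]), and from L log^(k+1) L to L log^k L
    ([LlogL_maximal]).  Applying them twice, from [f] to [G] and from [G] to [H],
    gives the square of the factor in Lp and the loss of two logarithms.  Each step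
    also puts its maximal function in L1, hence makes the next one finite almost
    everywhere. *)

Set Implicit Arguments.
Unset Strict Implicit.
Unset Printing Implicit Defensive.

(** * The layer-cake formula *)

Lemma integral_derive_itv (R : realType) (a : R) (F f : R -> R) (x : R) :
  (forall t, a <= t -> is_derive t 1 F (f t)) ->
  (forall t, a <= t -> {for t, continuous f}) -> a <= x ->
  (\int[lebesgue_measure]_(t in `]a, x[%classic) (f t)%:E = (F x - F a)%:E)%E.
Proof.
move=> dF cf; rewrite le_eqVlt => /predU1P[<-|ax].
  by rewrite set_itvoo0// integral_set0 subrr.
have cw : {within `[a, x]%classic, continuous f}.
  apply: continuous_in_subspaceT => t; rewrite inE/= in_itv/= => /andP[at0 _].
  exact: cf.
have mf : measurable_fun `[a, x]%classic (EFin \o f).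
  apply/measurable_EFinP; exact: subspace_continuous_measurable_fun.
rewrite -(@integral_itv_bndoo R a x (EFin \o f) true false)//; last first.
  by apply: measurable_funS mf => //; apply: subset_itvW.
rewrite (@continuous_FTC2 R f F a x)// ?EFinB//.
- have cF t : a <= t -> {for t, continuous F}.
    move=> at0; apply: differentiable_continuous; apply/derivable1_diffP.
    by have [] := dF t at0.
  split.
  + by move=> t; rewrite in_itv/= => /andP[/ltW at0 _]; have [] := dF t at0.
  + exact/cvg_at_right_filter/cF.
  + by apply/cvg_at_left_filter/cF/ltW.
- move=> t; rewrite in_itv/= => /andP[/ltW at0 _].
  by rewrite derive1E; have [_ ->] := dF t at0.
Qed.

Section layer_cake.
Context d (T : measurableType d) (R : realType).
Variable mu : {finite_measure set T -> \bar R}.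

Lemma measurable_gt (g : T -> R) (l : R) :
  measurable_fun [set: T] g -> measurable [set w | l < g w].
Proof.
move=> mg; rewrite -[X in measurable X]setTI.
rewrite (_ : [set w | l < g w] = g @^-1` `]l, +oo[%classic); first exact: mg.
by apply/seteqP; split => w /=; rewrite in_itv/= andbT.
Qed.

(** Writing [F x - F a] as the integral of [F' = f] over [a < t < x] turns the
    left-hand side into a double integral of [c w * f t] over the region
    [a < t < g w]; the formula is Tonelli's theorem on that region. *)
Lemma layer_cake_eq (a : R) (F f : R -> R) (c g : T -> R) :
  (forall t, a <= t -> is_derive t 1 F (f t)) ->
  (forall t, a <= t -> {for t, continuous f}) ->
  (forall t, a <= t -> 0 <= f t) ->
  measurable_fun [set: T] c -> (forall w, 0 <= c w) ->
  measurable_fun [set: T] g ->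
  (\int[mu]_w (c w * (F (Num.max a (g w)) - F a))%:E =
   \int[lebesgue_measure]_(t in `]a, +oo[%classic)
     ((f t)%:E * \int[mu]_(w in [set w | (t < g w)%R]) (c w)%:E))%E.
Proof.
move=> dF cf f0 mc c0 mg.
pose D := `]a, +oo[%classic : set R.
pose f' : R -> R := f \_ D.
have f'E t : f' t = if a < t then f t else 0.
  by rewrite /f' patchE; congr (if _ then _ else _); apply/idP/idP;
    rewrite inE /D/= in_itv/= andbT.
have f'0 t : 0 <= f' t.
  by rewrite f'E; case: ltP => // /ltW; exact: f0.
have mf' : measurable_fun [set: R] f'.
  have mD : measurable D by exact: measurable_itv.
  apply: (proj1 (measurable_restrictT f mD)).
  apply: subspace_continuous_measurable_fun => //.
  apply: continuous_in_subspaceT => t.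
  by rewrite inE /D/= in_itv/= andbT => /ltW; exact: cf.
pose G (z : T * R) : \bar R := (c z.1 * (f' z.2 * (z.2 < g z.1)%R%:R))%:E.
have mG : measurable_fun [set: T * R] G.
  apply/measurable_EFinP; apply: measurable_funM.
    exact: measurableT_comp.
  apply: measurable_funM; first exact: measurableT_comp.
  have mb : measurable_fun [set: T * R] (fun z : T * R => z.2 < g z.1).
    by apply: measurable_fun_ltr => //; exact: measurableT_comp.
  by apply: (measurableT_comp (f := fun b : bool => b%:R : R)).
have G0 z : (0 <= G z)%E.
  by rewrite lee_fin mulr_ge0// mulr_ge0.
transitivity (\int[mu]_w \int[lebesgue_measure]_t G (w, t))%E.
  apply: eq_integral => w _.
  rewrite EFinM -(@integral_derive_itv R a F f)//; last by rewrite le_max lexx.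
  rewrite integral_mkcond -ge0_integralZl_EFin//.
  - apply: eq_integral => t _; rewrite /G/= EFinM; congr (_ * _)%E.
    rewrite patchE.
    have -> : (t \in `]a, Num.max a (g w)[%classic) = (a < t) && (t < g w).
      apply/idP/idP; rewrite inE/= in_itv/= lt_max.
        move=> /andP[at0 /orP[ta|->]]; last by rewrite at0.
        by move: (lt_trans at0 ta); rewrite ltxx.
      by move=> /andP[-> ->]; rewrite orbT.
    rewrite f'E; case: (a < t) => /=; last by rewrite mul0r.
    by case: (t < g w); rewrite ?mulr1 ?mulr0.
  - move=> t _; rewrite patchE; case: ifPn => // /[!inE]/=.
    by rewrite in_itv/= lee_fin => /andP[/ltW h _]; exact: f0.
  - apply: (proj1 (measurable_restrictT _ _)) => //; apply/measurable_EFinP.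
    apply: subspace_continuous_measurable_fun => //.
    apply: continuous_in_subspaceT => t.
    by rewrite inE/= in_itv/= => /andP[/ltW h _]; exact: cf.
transitivity (\int[lebesgue_measure]_t \int[mu]_w G (w, t))%E.
  exact: fubini_tonelli.
rewrite [RHS]integral_mkcond.
apply: eq_integral => t _; rewrite patchE.
have mt : measurable [set w | t < g w] by exact: measurable_gt.
case: ifPn => tD.
  rewrite [X in (_ * X)%E]integral_mkcond -ge0_integralZl_EFin//.
  - apply: eq_integral => w _; rewrite /G/= /f' !patchE tD.
    have -> : (w \in [set w | t < g w]) = (t < g w).
      by apply/idP/idP; rewrite inE.
    by case: (t < g w); rewrite ?mulr1 ?mulr0 ?mule0// -EFinM mulrC.
  - by move=> w _; rewrite patchE; case: ifP => //; rewrite lee_fin.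
  - by apply: (proj1 (measurable_restrictT _ _)) => //;
      apply/measurable_EFinP; exact: measurable_funTS.
  - by apply: f0; move: tD; rewrite inE /D/= in_itv/= andbT => /ltW.
rewrite integral0_eq// => w _; rewrite /G/= /f' patchE (negbTE tD).
by rewrite mul0r mulr0.
Qed.

(** The left-hand side integrates [F' t = t * f t] against the tail of [g].  The
    factor [t] is absorbed by the bound on that tail, which leaves the truncated
    integrals of [c] integrated against [f], and [P] is a primitive of [f].  The function [v] that truncates [c] need not be [g]: the Lp
    inequality takes [v = g], the LlogL one takes [v = c]. *)
Lemma layer_cake_le (a : R) (F P f : R -> R) (c g v : T -> R) :
  0 < a ->
  (forall t, a <= t -> is_derive t 1 F (t * f t)) ->
  (forall t, a <= t -> is_derive t 1 P (f t)) ->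
  (forall t, a <= t -> {for t, continuous f}) ->
  (forall t, a <= t -> 0 <= f t) ->
  measurable_fun [set: T] c -> (forall w, 0 <= c w) ->
  measurable_fun [set: T] g -> measurable_fun [set: T] v ->
  (forall t, (a < t)%R -> t%:E * mu [set w | (t < g w)%R] <=
     \int[mu]_(w in [set w | (t < v w)%R]) (c w)%:E)%E ->
  (\int[mu]_w (F (Num.max a (g w)) - F a)%:E <=
   \int[mu]_w (c w * (P (Num.max a (v w)) - P a))%:E)%E.
Proof.
move=> a0 dF dP cf f0 mc c0 mg mv H.
have ctf t : a <= t -> {for t, continuous (fun x : R => x * f x)}.
  by move=> at0; apply: continuousM; [exact: cvg_id|exact: cf].
rewrite (@layer_cake_eq a P f c v)//.
under eq_integral do rewrite -[_ - _]mul1r.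
rewrite (@layer_cake_eq a F (fun x : R => x * f x) (cst 1) g)//; last first.
  by move=> t at0; rewrite mulr_ge0 ?f0//; apply: le_trans at0; exact: ltW.
have mint (k h : T -> R) : measurable_fun [set: T] k -> (forall w, 0 <= k w) ->
    measurable_fun [set: T] h -> measurable_fun [set: R]
    (fun t => (\int[mu]_(w in [set w | (t < h w)%R]) (k w)%:E)%E).
  move=> mk k0 mh.
  pose K (z : T * R) : \bar R := (k z.1 * (z.2 < h z.1)%R%:R)%:E.
  have mK : measurable_fun [set: T * R] K.
    apply/measurable_EFinP; apply: measurable_funM.
      exact: measurableT_comp.
    have mb : measurable_fun [set: T * R] (fun z : T * R => z.2 < h z.1).
      by apply: measurable_fun_ltr => //; exact: measurableT_comp.
    by apply: (measurableT_comp (f := fun b : bool => b%:R : R)).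
  have K0 z : (0 <= K z)%E by rewrite lee_fin mulr_ge0.
  have := @measurable_fun_fubini_tonelli_G _ _ _ _ _ mu K mK K0.
  congr (measurable_fun _ _); apply/funext => t; rewrite /fubini_G.
  rewrite [RHS]integral_mkcond; apply: eq_integral => w _; rewrite /K/= patchE.
  have -> : (w \in [set w | t < h w]) = (t < h w).
    by apply/idP/idP; rewrite inE.
  by case: (t < h w); rewrite ?mulr1 ?mulr0.
have mff : measurable_fun `]a, +oo[%classic f.
  apply: subspace_continuous_measurable_fun => //.
  apply: continuous_in_subspaceT => t.
  by rewrite inE/= in_itv/= andbT => /ltW; exact: cf.
apply: ge0_le_integral => //.
- move=> t /=; rewrite in_itv/= andbT => /ltW at0.
  apply: mule_ge0; last by apply: integral_ge0 => w _; rewrite lee_fin.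
  by rewrite lee_fin mulr_ge0 ?f0//; apply: le_trans at0; exact: ltW.
- apply: emeasurable_funM; last by apply: measurable_funTS; exact: mint.
  by apply/measurable_EFinP; exact: measurable_funM.
- apply: emeasurable_funM; last by apply: measurable_funTS; exact: mint.
  exact/measurable_EFinP.
move=> t /=; rewrite in_itv/= andbT => at0.
rewrite integral_cst ?mul1e; last exact: measurable_gt.
rewrite mulrC EFinM -muleA; apply: lee_wpmul2l; last exact: H.
by rewrite lee_fin f0// ltW.
Qed.
End layer_cake.

(** * Weak and strong maximal inequalities in Lp *)

Section weak_maximal.
Context d (T : measurableType d) (R : realType).
Variable mu : {finite_measure set T -> \bar R}.

Lemma integral_le_bigcup (A : (set T)^nat) (h : T -> \bar R) (C : \bar R) :
  nondecreasing_seq A -> (forall n, measurable (A n)) ->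
  measurable_fun (\bigcup_n A n) h ->
  (forall w, (\bigcup_n A n) w -> 0 <= h w)%E ->
  (forall n, \int[mu]_(w in A n) h w <= C)%E ->
  (\int[mu]_(w in \bigcup_n A n) h w <= C)%E.
Proof.
move=> ndA mA mh h0 hC.
have cv : (\int[mu]_(w in A n) h w @[n --> \oo] -->
    \int[mu]_(w in \bigcup_n A n) h w)%E.
  apply: ge0_nondecreasing_set_cvg_integral => //.
  - move=> n; apply: measurable_funS mh; first exact: bigcup_measurable.
    exact: bigcup_sup.
  - by move=> n w Aw; apply: h0; exists n.
rewrite -(cvg_lim _ cv)//; apply: lime_le; first by apply/cvg_ex; eexists; exact: cv.
exact: nearW.
Qed.

Lemma fin_num_mu (A : set T) : measurable A -> (mu A \is a fin_num)%E.
Proof. by move=> mA; exact: fin_num_measure. Qed.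

(** The weak-type inequality shared by Doob's maximal function [g] of a
    martingale closed by [f] and by the maximal function [g] of the ergodic
    averages of [f]. *)
Definition weak_maximal (f g : T -> \bar R) : Prop :=
  forall l : R, 0 < l ->
    (l%:E * mu [set w | (l%:E < g w)%E] <=
     \int[mu]_(w in [set w | (l%:E < g w)%E]) f w)%E.

(** Young's inequality with the exponents [p] and [p / (p - 1)]. *)
Lemma young_maximal (p x y : R) : 1 < p -> 0 <= x -> 0 <= y ->
  x * y `^ (p - 1) <= p^-1 * x `^ p + (1 - p^-1) * y `^ p.
Proof.
move=> p1 x0 y0.
have p0 : 0 < p by apply: lt_trans p1.
have p10 : 0 < p - 1 by rewrite subr_gt0.
have q0 : 0 < p / (p - 1) by rewrite divr_gt0.
have := @conjugate_powR R x (y `^ (p - 1)) p (p / (p - 1)) x0 (powR_ge0 _ _) p0 q0.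
have -> : (p / (p - 1))^-1 = 1 - p^-1.
  by field; rewrite !gt_eqF.
rewrite -powRrM (_ : (p - 1) * (p / (p - 1)) = p); last by field; rewrite gt_eqF.
by rewrite (mulrC (x `^ p)) (mulrC (y `^ p)); apply; rewrite addrC subrK.
Qed.

(** Doob's passage from weak to strong type.  The layer-cake comparison with
    [F t = t ^ p] gives, with [q = p / (p - 1)], that the integral of [g ^ p] is
    at most that of [q * f * g ^ (p - 1)]; Young's inequality bounds the latter
    by [1/p] times the integral of [(q * f) ^ p] plus [1 - 1/p] times that of
    [g ^ p], and the last term is moved to the left.  This absorption needs a
    finite integral of [g ^ p], whence the truncation of [g] at height [n]; the
    layer-cake formula needs to stay away from 0, whence the cut-off of [g]
    below [e]. *)
Lemma strong_maximal_Lp (p : R) (f g : T -> R) : 1 < p ->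
  measurable_fun [set: T] f -> measurable_fun [set: T] g ->
  (forall w, 0 <= f w) -> (forall w, 0 <= g w) ->
  weak_maximal (EFin \o f) (EFin \o g) ->
  (\int[mu]_w (g w `^ p)%:E <=
   ((p / (p - 1)) `^ p)%:E * \int[mu]_w (f w `^ p)%:E)%E.
Proof.
move=> p1 mf mg f0 g0 wfg.
have p0 : 0 < p by apply: lt_trans p1.
have p10 : 0 < p - 1 by rewrite subr_gt0.
set q := p / (p - 1).
have q0 : 0 < q by rewrite divr_gt0.
rewrite -ge0_integralZl_EFin ?powR_ge0//; last 2 first.
- by move=> w _; rewrite lee_fin powR_ge0.
- by apply/measurable_EFinP; exact: (measurableT_comp (measurable_powR _)).
under eq_integral do rewrite -EFinM -powRM ?(ltW q0)//.
set J := (\int[mu]_w ((q * f w) `^ p)%:E)%E.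
have mJ : measurable_fun [set: T] (fun w => ((q * f w) `^ p)%:E).
  apply/measurable_EFinP; apply: (measurableT_comp (measurable_powR _)).
  exact: measurable_funM.
have J0 : (0 <= J)%E by apply: integral_ge0 => w _; rewrite lee_fin powR_ge0.
have [->|Jfin] := eqVneq J +oo%E; first by rewrite leey.
have {Jfin}Jfin : J \is a fin_num by rewrite ge0_fin_numE// ltey.
set m := fine (mu [set: T]).
have m0 : 0 <= m by exact: fine_ge0.
have muE : mu [set: T] = m%:E by rewrite fineK// fin_num_mu.
have step (n : nat) (e : R) : 0 < e ->
    (\int[mu]_(w in [set w | (g w <= n%:R)%R]) (g w `^ p)%:E <=
     (p * (e `^ p * m))%:E + J)%E.
  move=> e0.
  pose gn w := Num.min (g w) n%:R.
  have mgn : measurable_fun [set: T] gn by exact: measurable_minr.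
  pose b w := Num.max e (gn w).
  have mb : measurable_fun [set: T] b by exact: measurable_maxr.
  have b0 w : 0 < b w by rewrite lt_max e0.
  have mbp : measurable_fun [set: T] (fun w => (b w `^ p)%:E).
    by apply/measurable_EFinP; apply: (measurableT_comp (measurable_powR _)).
  set B := (\int[mu]_w (b w `^ p)%:E)%E.
  have B0 : (0 <= B)%E by apply: integral_ge0 => w _; rewrite lee_fin powR_ge0.
  have Bfin : B \is a fin_num.
    rewrite ge0_fin_numE//.
    apply: (@le_lt_trans _ _ (\int[mu]_w (cst ((Num.max e n%:R) `^ p)%:E w))%E).
      apply: ge0_le_integral => //.
      - by move=> w _; rewrite lee_fin powR_ge0.
      - move=> w _; rewrite lee_fin ge0_ler_powR ?nnegrE ?(ltW p0)//.
        + exact: ltW.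
        + by rewrite le_max ltW.
        by rewrite /b /gn ge_max !le_max lexx/= !ge_min lexx !orbT.
    rewrite integral_cst//; apply: lte_mul_pinfty.
    - by rewrite lee_fin powR_ge0.
    - by [].
    - by rewrite [X in (X < _)%E]muE ltry.
  have lc : (\int[mu]_w (b w `^ p - e `^ p)%:E <=
      \int[mu]_w (f w * (q * b w `^ (p - 1) - q * e `^ (p - 1)))%:E)%E.
    apply: (@layer_cake_le _ _ _ mu e (@powR R ^~ p)
      (fun x => q * x `^ (p - 1)) (fun x => p * x `^ (p - 1 - 1)) f gn gn) => //.
    - move=> t et; have t0 : 0 < t by exact: lt_le_trans et.
      apply: (is_derive_eq (is_derive1_powR p t0)).
      rewrite [X in p * X](_ : _ = t * t `^ (p - 1 - 1)); first by ring.
      rewrite -{2}(powRr1 (ltW t0)) -powRD; last first.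
        by rewrite (gt_eqF t0) implybT.
      by congr (_ `^ _); ring.
    - move=> t et; have t0 : 0 < t by exact: lt_le_trans et.
      have dt := is_deriveZ q (is_derive1_powR (p - 1) t0).
      have <- : q *: ((p - 1) * t `^ (p - 1 - 1)) = p * t `^ (p - 1 - 1).
        by rewrite /GRing.scale/= mulrA /q divfK// gt_eqF.
      exact: dt.
    - move=> t et; have t0 : 0 < t by exact: lt_le_trans et.
      apply: continuousM; first exact: cvg_cst.
      apply: differentiable_continuous; apply/derivable1_diffP.
      by have [] := is_derive1_powR (p - 1 - 1) t0.
    - by move=> t et; rewrite mulr_ge0 ?powR_ge0 ?ltW.
    - move=> t et; have t0 : 0 < t by exact: lt_trans et.
      rewrite /gn; case: (ltP t n%:R) => tn.
        rewrite (_ : [set w | t < Num.min (g w) n%:R] = [set w | t < g w]).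
          exact: wfg.
        by apply/seteqP; split=> w /=; rewrite lt_min tn andbT.
      rewrite (_ : [set w | t < Num.min (g w) n%:R] = set0).
        by rewrite measure0 mule0 integral_set0.
      by apply/seteqP; split=> w //=; rewrite lt_min ltNge (ltNge _ n%:R) tn andbF.
  have mng : measurable [set w | (g w <= n%:R)%R].
    rewrite -[X in measurable X]setTI.
    rewrite (_ : [set w | g w <= n%:R] = g @^-1` `]-oo, n%:R]%classic); first exact: mg.
    by apply/seteqP; split => w /=; rewrite in_itv/=.
  apply: (@le_trans _ _ B).
    apply: (@le_trans _ _ (\int[mu]_(w in [set w | (g w <= n%:R)%R]) (b w `^ p)%:E)%E).
      apply: ge0_le_integral => //.
      - by move=> w _; rewrite lee_fin powR_ge0.
      - apply: measurable_funTS; apply/measurable_EFinP.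
        exact: (measurableT_comp (measurable_powR _)).
      - exact: measurable_funTS.
      - move=> w /= gwn; rewrite lee_fin ge0_ler_powR ?nnegrE ?(ltW p0) ?(ltW (b0 w))//.
        by rewrite /b le_max /gn le_min lexx gwn orbT.
    apply: ge0_subset_integral => //.
    by move=> w _; rewrite lee_fin powR_ge0.
  have be w : e `^ p <= b w `^ p.
    by rewrite ge0_ler_powR ?nnegrE ?(ltW p0) ?(ltW e0) ?(ltW (b0 w))// /b le_max lexx.
  have B1 : (B <= (e `^ p * m)%:E + \int[mu]_w (b w `^ p - e `^ p)%:E)%E.
    have -> : ((e `^ p * m)%:E = \int[mu]_w (cst (e `^ p)%:E w))%E.
      by rewrite integral_cst// EFinM; congr (_ * _)%E; exact: esym muE.
    rewrite -ge0_integralD//.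
    - by rewrite le_eqVlt; apply/orP; left; apply/eqP/eq_integral => w _;
        rewrite -EFinD addrC subrK.
    - by move=> w _; rewrite lee_fin powR_ge0.
    - by move=> w _; rewrite lee_fin subr_ge0.
    - by apply/measurable_EFinP; apply: measurable_funB => //; apply/measurable_EFinP.
  have B2 : (\int[mu]_w (f w * (q * b w `^ (p - 1) - q * e `^ (p - 1)))%:E <=
      (p^-1)%:E * J + (1 - p^-1)%:E * B)%E.
    have ip : p^-1 <= 1 by rewrite invf_le1// ltW.
    rewrite -!ge0_integralZl_EFin//.
    - rewrite -ge0_integralD//.
      + apply: ge0_le_integral => //.
        * move=> w _; rewrite lee_fin mulr_ge0//.
          rewrite subr_ge0 ler_wpM2l ?(ltW q0)// ge0_ler_powR ?nnegrE ?(ltW p10) ?(ltW e0) ?(ltW (b0 w))//.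
          by rewrite /b le_max lexx.
        * apply/measurable_EFinP; apply: measurable_funM => //.
          apply: measurable_funB => //; apply: measurable_funM => //.
          exact: (measurableT_comp (measurable_powR _)).
        * by apply: emeasurable_funD; apply: emeasurable_funM.
        * move=> w _; rewrite -!EFinM -EFinD lee_fin.
          have qf0 : 0 <= q * f w by rewrite mulr_ge0// ltW.
          apply: (le_trans _ (young_maximal p1 qf0 (ltW (b0 w)))).
          rewrite [leRHS](_ : _ = f w * (q * b w `^ (p - 1))); last by ring.
          apply: ler_wpM2l => //.
          by rewrite gerBl mulr_ge0 ?powR_ge0// ltW.
      + by move=> w _; rewrite -EFinM lee_fin mulr_ge0 ?powR_ge0 ?invr_ge0 ?(ltW p0).
      + exact: emeasurable_funM.
      + by move=> w _; rewrite -EFinM lee_fin mulr_ge0 ?powR_ge0 ?subr_ge0.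
      + exact: emeasurable_funM.
    - by move=> w _; rewrite lee_fin powR_ge0.
    - by rewrite subr_ge0.
    - by move=> w _; rewrite lee_fin powR_ge0.
    - by rewrite invr_ge0 ltW.
  have := le_trans B1 (leeD (le_refl _) (le_trans lc B2)).
  rewrite -(fineK Bfin) -(fineK Jfin) -!EFinM -!EFinD !lee_fin => h.
  rewrite -(ler_pM2l (_ : 0 < p^-1)) ?invr_gt0//.
  rewrite mulrDr mulKf ?gt_eqF//.
  by lra.
have Jle (n : nat) :
   (\int[mu]_(w in [set w | (g w <= n%:R)%R]) (g w `^ p)%:E <= J)%E.
  apply/lee_addgt0Pr => e e0.
  (* chosen so that p * c ^ p * m = e * m / (m + 1) <= e *)
  pose c := (e / (p * (m + 1))) `^ p^-1.
  have m1 : 0 < m + 1 by rewrite ltr_wpDl.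
  have c0 : 0 < c by rewrite powR_gt0// divr_gt0// mulr_gt0.
  apply: (le_trans (step n c c0)); rewrite addeC leeD2l// lee_fin.
  have em0 : 0 <= e / (p * (m + 1)) by rewrite ltW// divr_gt0// mulr_gt0.
  rewrite /c -powRrM mulVf ?gt_eqF// powRr1//.
  rewrite (_ : p * _ = e * (m / (m + 1))); last by field; rewrite !gt_eqF.
  by rewrite ger_pMr// ler_pdivrMr// mul1r lerDl.
have cupE : \bigcup_n [set w | g w <= n%:R] = [set: T].
  apply/seteqP; split=> // w _.
  exists (Num.truncn (g w)).+1 => //=.
  by rewrite ltW// truncnS_gt.
rewrite -cupE; apply: integral_le_bigcup => //.
- apply/nondecreasing_seqP => n; apply/subsetPset => w /= h.
  by apply: (le_trans h); rewrite ler_nat.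
- move=> n; rewrite -[X in measurable X]setTI.
  rewrite (_ : [set w | g w <= n%:R] = g @^-1` `]-oo, n%:R]%classic); first exact: mg.
  by apply/seteqP; split => w /=; rewrite in_itv/=.
- rewrite cupE; apply/measurable_EFinP.
  exact: (measurableT_comp (measurable_powR _)).
- by move=> w _; rewrite lee_fin powR_ge0.
Qed.
End weak_maximal.

(** * The strong maximal inequality in the classes L log^k L *)

Section LlogL.
Context d (T : measurableType d) (R : realType).
Variable mu : {finite_measure set T -> \bar R}.

Local Notation L x := (ln (Num.max 1 x)).

Lemma lnmax1_ge0 (x : R) : 0 <= L x.
Proof. by rewrite ln_ge0// le_max lexx. Qed.

Lemma measurable_lnmax1X (f : T -> R) k : measurable_fun [set: T] f ->
  measurable_fun [set: T] (fun w => L (f w) ^+ k).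
Proof.
move=> mf; apply: measurable_funX.
apply: (@measurableT_comp _ _ _ _ _ _ (@ln R)); first exact: measurable_ln.
exact: measurable_maxr.
Qed.

(** Below [expR 1] the constant dominates, above it the logarithm exceeds 1; on a
    finite measure space it follows that L log^k L is contained in L1. *)
Lemma le_LlogL (k : nat) (x : R) : 0 <= x -> x <= expR 1 + x * L x ^+ k.
Proof.
move=> x0; have [xe|ex] := leP x (expR 1).
  by apply: (le_trans xe); rewrite lerDl mulr_ge0 ?exprn_ge0 ?lnmax1_ge0.
have x0' : 0 < x by apply: lt_trans ex; exact: expR_gt0.
have L1 : 1 <= L x.
  rewrite -[leLHS]expRK ler_ln ?posrE ?expR_gt0 ?lt_max ?x0' ?orbT//.
  by rewrite le_max (ltW ex) orbT.
apply: (@le_trans _ _ (x * L x ^+ k)); last by rewrite lerDr expR_ge0.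
by rewrite ler_peMr// exprn_ege1.
Qed.

Lemma is_derive_lnX (k : nat) (t : R) : 0 < t ->
  is_derive t 1 (fun x : R => ln x ^+ k) (k%:R * ln t ^+ k.-1 / t).
Proof.
by move=> t0; have := is_deriveX k (is_derive1_ln t0); rewrite exprfctE.
Qed.

Lemma is_derive_xlnX (k : nat) (t : R) : 0 < t ->
  is_derive t 1 (fun x : R => x * ln x ^+ k)
    (ln t ^+ k + k%:R * ln t ^+ k.-1).
Proof.
move=> t0; have h := is_deriveM (is_derive_id t 1) (is_derive_lnX k t0).
have <- : t *: (k%:R * ln t ^+ k.-1 / t) + ln t ^+ k *: 1 =
    ln t ^+ k + k%:R * ln t ^+ k.-1.
  by rewrite /GRing.scale/= mulr1 addrC mulrC divfK// gt_eqF.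
exact: h.
Qed.

(** Where [2 * f <= l] the integrand [f] contributes at most half of the left-hand
    side, which can be absorbed because the measure is finite.  The tail of [g]
    is thereby controlled by the large values of [f] alone, with no further
    reference to [g]. *)
Lemma weak_maximal_improved (f g : T -> R) :
  measurable_fun [set: T] f -> measurable_fun [set: T] g ->
  (forall w, 0 <= f w) ->
  weak_maximal mu (EFin \o f) (EFin \o g) ->
  forall l : R, 0 < l -> (l%:E * mu [set w | (l < g w)%R] <=
    \int[mu]_(w in [set w | (l < 2 * f w)%R]) (2 * f w)%:E)%E.
Proof.
move=> mf mg f0 wfg l l0.
have mgl : measurable [set w | l < g w] by exact: measurable_gt.
have m2f : measurable_fun [set: T] (fun w => 2 * f w) by exact: measurable_funM.
have mfl : measurable [set w | l < 2 * f w] by exact: (measurable_gt _ m2f).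
under eq_integral do rewrite EFinM.
rewrite ge0_integralZl_EFin//; last 2 first.
- by move=> w _; rewrite lee_fin.
- by apply/measurable_EFinP; exact: measurable_funTS.
set J := (\int[mu]_(w in _) _)%E.
have J0 : (0 <= J)%E by apply: integral_ge0 => w _; rewrite lee_fin.
have [->|Jfin] := eqVneq J +oo%E; first by rewrite mulry gtr0_sg// mul1e leey.
have {Jfin}Jfin : J \is a fin_num by rewrite ge0_fin_numE// ltey.
have key : (\int[mu]_(w in [set w | (l < g w)%R]) (f w)%:E <=
    J + (l / 2)%:E * mu [set w | (l < g w)%R])%E.
  rewrite -integral_cst// /J [leLHS]integral_mkcond.
  rewrite (integral_mkcond [set w | l < 2 * f w]).
  rewrite (integral_mkcond [set w | l < g w]) -ge0_integralD//.
  - apply: ge0_le_integral => //.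
    + by move=> w _; rewrite patchE; case: ifP; rewrite // lee_fin.
    + apply: (proj1 (measurable_restrictT _ _)) => //.
      by apply/measurable_EFinP; exact: measurable_funTS.
    + apply: emeasurable_funD; apply: (proj1 (measurable_restrictT _ _)) => //.
      by apply/measurable_EFinP; exact: measurable_funTS.
    + move=> w _; rewrite !patchE.
      have -> : (w \in [set w | l < g w]) = (l < g w) by apply/idP/idP; rewrite inE.
      have -> : (w \in [set w | l < 2 * f w]) = (l < 2 * f w).
        by apply/idP/idP; rewrite inE.
      have := f0 w.
      by case: (l < g w); case: ltP => h1 h2;
        rewrite ?adde0 ?add0e -?EFinD ?lee_fin//=; lra.
  - by move=> w _; rewrite patchE; case: ifP; rewrite // lee_fin.
  - apply: (proj1 (measurable_restrictT _ _)) => //.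
    by apply/measurable_EFinP; exact: measurable_funTS.
  - by move=> w _; rewrite patchE; case: ifP; rewrite // lee_fin divr_ge0// ltW.
  - exact: (proj1 (measurable_restrictT _ _)).
have mufin : mu [set w | (l < g w)%R] \is a fin_num by exact: fin_num_mu.
have := le_trans (wfg l l0) key.
rewrite (_ : [set w | (l%:E < (EFin \o g) w)%E] = [set w | l < g w]); last first.
  by apply/seteqP; split => w /=; rewrite lte_fin.
rewrite -(fineK mufin) -(fineK Jfin) -!EFinM -!EFinD !lee_fin.
by lra.
Qed.

(** One logarithm is lost: in the layer-cake comparison [x * ln x ^ k] has the
    derivative [t * phi t], and the primitive of [phi] grows like
    [ln x ^ (k + 1)].  As the tail bound truncates [2 * f] by itself, the outcome
    is the integral of [2 * f * Psi (2 * f)], which is at most a multiple of the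
    L log^(k+1) L integral of [f] plus a constant. *)
Lemma LlogL_maximal (k : nat) (f g : T -> R) :
  measurable_fun [set: T] f -> measurable_fun [set: T] g ->
  (forall w, 0 <= f w) -> (forall w, 0 <= g w) ->
  weak_maximal mu (EFin \o f) (EFin \o g) ->
  (\int[mu]_w (f w * L (f w) ^+ k.+1)%:E < +oo)%E ->
  (\int[mu]_w (g w * L (g w) ^+ k)%:E < +oo)%E.
Proof.
move=> mf mg f0 g0 wfg If.
pose phi (x : R) : R := (ln x ^+ k + k%:R * ln x ^+ k.-1) / x.
pose Phi (x : R) : R := x * ln x ^+ k.
pose Psi (x : R) : R := k.+1%:R^-1 * ln x ^+ k.+1 + ln x ^+ k.
pose v w := 2 * f w.
have mv : measurable_fun [set: T] v by exact: measurable_funM.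
have v0 w : 0 <= v w by rewrite mulr_ge0.
have lc : (\int[mu]_w (Phi (Num.max 1 (g w)) - Phi 1)%:E <=
    \int[mu]_w (v w * (Psi (Num.max 1 (v w)) - Psi 1))%:E)%E.
  apply: (@layer_cake_le _ _ _ mu 1 Phi Psi phi) => //.
  - move=> t t1; have t0 : 0 < t by apply: lt_le_trans t1.
    rewrite /phi mulrC divfK ?gt_eqF//; exact: is_derive_xlnX.
  - move=> t t1; have t0 : 0 < t by apply: lt_le_trans t1.
    have h1 := is_deriveZ (k.+1%:R^-1 : R) (is_derive_lnX k.+1 t0).
    have h2 := is_deriveD h1 (is_derive_lnX k t0).
    have <- : k.+1%:R^-1 *: (k.+1%:R * ln t ^+ k.+1.-1 / t) + k%:R * ln t ^+ k.-1 / t = phi t.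
      rewrite /GRing.scale/= /phi -!mulrA mulKf ?pnatr_eq0//.
      by rewrite [in RHS]mulrDl !mulrA.
    exact: h2.
  - move=> t t1; have t0 : 0 < t by apply: lt_le_trans t1.
    have cX j : {for t, continuous (fun x : R => ln x ^+ j)}.
      apply: differentiable_continuous; apply/derivable1_diffP.
      by have [] := is_derive_lnX j t0.
    apply: continuousM; last by apply: continuousV; [rewrite gt_eqF|exact: cvg_id].
    apply: continuousD; first exact: cX.
    by apply: continuousM; [exact: cvg_cst|exact: cX].
  - move=> t t1; have t0 : 0 < t by apply: lt_le_trans t1.
    by rewrite divr_ge0 ?(ltW t0)// addr_ge0 ?mulr_ge0 ?exprn_ge0 ?ln_ge0.
  - move=> t t1; have t0 : 0 < t by apply: lt_trans t1.
    exact: (weak_maximal_improved mf mg).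
have mFin : (mu [set: T] < +oo)%E by rewrite -ge0_fin_numE// fin_num_mu.
have Phi1 : Phi 1 <= 1.
  by rewrite /Phi mul1r ln1 expr0n; case: eqP.
have Psi1 : 0 <= Psi 1.
  by rewrite /Psi ln1 addr_ge0 ?mulr_ge0 ?exprn_ge0.
have mPhi : measurable_fun [set: T] (fun w => Phi (Num.max 1 (g w)) - Phi 1).
  apply: measurable_funB => //; apply: measurable_funM; first exact: measurable_maxr.
  exact: measurable_lnmax1X.
have Phige w : Phi 1 <= Phi (Num.max 1 (g w)).
  rewrite /Phi ler_pM ?exprn_ge0 ?ln_ge0 ?le_max ?lexx//.
  by rewrite lerXn2r ?nnegrE ?ln_ge0 ?le_max ?lexx// ln1 lnmax1_ge0.
apply: (@le_lt_trans _ _ (\int[mu]_w ((Phi (Num.max 1 (g w)) - Phi 1)%:E + cst 1 w))%E).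
  apply: ge0_le_integral => //.
  - by move=> w _; rewrite lee_fin mulr_ge0 ?exprn_ge0 ?lnmax1_ge0.
  - apply/measurable_EFinP; apply: measurable_funM => //.
    exact: measurable_lnmax1X.
  - by apply: emeasurable_funD => //; apply/measurable_EFinP.
  - move=> w _; rewrite -EFinD lee_fin.
    apply: (@le_trans _ _ (Phi (Num.max 1 (g w)))); last by lra.
    by rewrite /Phi ler_wpM2r ?exprn_ge0 ?lnmax1_ge0// le_max lexx orbT.
rewrite ge0_integralD//; last 2 first.
- by move=> w _; rewrite lee_fin subr_ge0.
- exact/measurable_EFinP.
rewrite integral_cst// mul1e; apply: lte_add_pinfty => //.
apply: (le_lt_trans lc).
(* 2 f * Psi (2 f) <= 2 f * 2 * 2 ^ (k + 1) * (1 + L f ^ (k + 1)) *)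
pose C : R := 2 ^+ k.+3.
have C0 : 0 <= C by rewrite exprn_ge0.
have mfL : measurable_fun [set: T] (fun w => f w * L (f w) ^+ k.+1).
  by apply: measurable_funM => //; exact: measurable_lnmax1X.
apply: (@le_lt_trans _ _ (\int[mu]_w (C%:E * (cst (expR 1)%:E w + 2%:E * (f w * L (f w) ^+ k.+1)%:E)))%E).
  apply: ge0_le_integral => //.
  - move=> w _; rewrite lee_fin mulr_ge0// subr_ge0 /Psi ln1 !expr0n/=.
    rewrite mulr0 add0r.
    case: k {phi Phi Psi lc Phi1 Psi1 mPhi Phige C C0 mfL If} => [|k] /=.
      by rewrite expr0 expr1 lerDr mulr_ge0 ?lnmax1_ge0.
    apply: addr_ge0; last by rewrite exprn_ge0// lnmax1_ge0.
    by apply: mulr_ge0; rewrite ?invr_ge0 ?ler0n// exprn_ge0// lnmax1_ge0.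
  - apply/measurable_EFinP; apply: measurable_funM => //.
    apply: measurable_funB => //; apply: measurable_funD; last exact: measurable_lnmax1X.
    apply: measurable_funM => //; exact: measurable_lnmax1X.
  - apply: emeasurable_funM => //; apply: emeasurable_funD => //.
    by apply: emeasurable_funM => //; exact/measurable_EFinP.
  - move=> w _; rewrite /= -!EFinM lee_fin /v.
    have La : L (2 * f w) <= 1 + L (f w).
      apply: (@le_trans _ _ (ln (2 * Num.max 1 (f w)))).
        rewrite ler_ln ?posrE ?lt_max ?ltr01//; last by rewrite mulr_gt0// lt_max ltr01.
        rewrite ge_max; apply/andP; split; last by rewrite ler_pM2l// le_max lexx orbT.
        have : 1 <= Num.max 1 (f w) by rewrite le_max lexx.
        by lra.
      rewrite lnM ?posrE ?lt_max ?ltr01// lerD2r.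
      by have := @le_ln1Dx R 1; apply; lra.
    set l := L (f w) in La *.
    have l0 : 0 <= l by exact: lnmax1_ge0.
    have PsiL : Psi (Num.max 1 (2 * f w)) <= 2 * (1 + l) ^+ k.+1.
      rewrite /Psi [leRHS]mulr_natl mulr2n lerD//.
        rewrite -[leRHS]mul1r ler_pM ?exprn_ge0 ?lnmax1_ge0 ?invr_ge0//.
          by rewrite invf_le1// ler1n.
        by rewrite lerXn2r ?nnegrE ?lnmax1_ge0 ?addr_ge0.
      apply: (@le_trans _ _ ((1 + l) ^+ k)).
        by rewrite lerXn2r ?nnegrE ?lnmax1_ge0 ?addr_ge0.
      by rewrite exprS ler_peMl ?exprn_ge0 ?addr_ge0// lerDl.
    have lp : (1 + l) ^+ k.+1 <= 2 ^+ k.+1 * (1 + l ^+ k.+1).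
      apply: (@le_trans _ _ ((2 * Num.max 1 l) ^+ k.+1)).
        rewrite lerXn2r ?nnegrE ?addr_ge0 ?mulr_ge0 ?le_max ?ler01//.
        by rewrite /Num.max; case: ltP; lra.
      rewrite exprMn ler_pM2l ?exprn_gt0//.
      rewrite /Num.max; case: ltP => _; first by rewrite lerDr.
      by rewrite expr1n lerDl exprn_ge0.
    have fe := le_LlogL k.+1 (f0 w).
    rewrite -/l in fe.
    apply: (@le_trans _ _ (2 * f w * (2 * (2 ^+ k.+1 * (1 + l ^+ k.+1))))).
      apply: ler_wpM2l; first by rewrite mulr_ge0.
      apply: (@le_trans _ _ (Psi (Num.max 1 (2 * f w)))); first by rewrite gerBl.
      by apply: (le_trans PsiL); rewrite ler_pM2l.
    rewrite [leLHS](_ : _ = C * (f w + f w * l ^+ k.+1)); last by rewrite /C !exprS; ring.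
    by apply: ler_wpM2l => //; lra.
rewrite ge0_integralZl_EFin//; last 2 first.
- by move=> w _; rewrite -EFinM -EFinD lee_fin addr_ge0 ?expR_ge0 ?mulr_ge0 ?exprn_ge0 ?lnmax1_ge0.
- apply: emeasurable_funD => //; apply: emeasurable_funM => //; exact/measurable_EFinP.
apply: lte_mul_pinfty => //.
rewrite ge0_integralD//; last 3 first.
- by move=> w _; rewrite /= lee_fin expR_ge0.
- by move=> w _; rewrite -EFinM lee_fin ?mulr_ge0 ?exprn_ge0 ?lnmax1_ge0.
- by apply: emeasurable_funM => //; exact/measurable_EFinP.
apply: lte_add_pinfty.
  by rewrite integral_cst//; apply: lte_mul_pinfty.
rewrite ge0_integralZl_EFin//; last 2 first.
- by move=> w _; rewrite lee_fin ?mulr_ge0 ?exprn_ge0 ?lnmax1_ge0.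
- exact/measurable_EFinP.
exact: lte_mul_pinfty.
Qed.
End LlogL.

(** * Running maxima *)

Section running_max.
Context d (T : measurableType d) (R : realType).

(** The maximum of 0 and of the first [K] terms; starting from 0 makes it
    nonnegative and does not change its level sets at positive levels. *)
Fixpoint runmax (a : nat -> T -> R) (K : nat) (w : T) : R :=
  if K is K'.+1 then Num.max (runmax a K' w) (a K' w) else 0.

Lemma runmaxS a K w : runmax a K.+1 w = Num.max (runmax a K w) (a K w).
Proof. by []. Qed.

Lemma runmax_ge0 a K w : 0 <= runmax a K w.
Proof. by elim: K => [|K IH]; rewrite ?runmaxS ?le_max ?IH. Qed.

Lemma runmax_nd a w : nondecreasing_seq (fun K => runmax a K w).
Proof. by apply/nondecreasing_seqP => K; rewrite runmaxS le_max lexx. Qed.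

Lemma runmax_gtP a K w (l : R) : 0 <= l ->
  (l < runmax a K w) <-> exists2 k, (k < K)%N & l < a k w.
Proof.
move=> l0; elim: K => [|K IH].
  by rewrite /runmax; split=> [/(le_lt_trans l0)|[]//]; rewrite ltxx.
rewrite runmaxS lt_max; split=> [/orP[/IH[k kK la]|la]|[k]].
- by exists k => //; apply: ltnW.
- by exists K.
- by rewrite ltnS leq_eqVlt => /predU1P[->->|kK la]; rewrite ?orbT//;
    apply/orP; left; apply/IH; exists k.
Qed.

Lemma runmax_ge a K k w : (k < K)%N -> a k w <= runmax a K w.
Proof.
elim: K => // K IH; rewrite runmaxS le_max ltnS leq_eqVlt.
by move=> /predU1P[->|/IH ->//]; rewrite lexx orbT.
Qed.

Lemma measurable_runmax a K : (forall k, measurable_fun [set: T] (a k)) ->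
  measurable_fun [set: T] (runmax a K).
Proof.
move=> ma; elim: K => [|K IH]; first exact: measurable_cst.
by apply: (@measurable_maxr _ _ _ _ (runmax a K)).
Qed.

End running_max.
Arguments runmax : simpl never.

(** * The maximal ergodic theorem *)

Section hopf.
Context d (T : measurableType d) (R : realType).
Variable mu : {finite_measure set T -> \bar R}.
Variables (tau : T -> T) (htau : measure_preserving mu tau).

Lemma ge0_integral_preserving (f : T -> \bar R) :
  measurable_fun [set: T] f -> (forall w, 0 <= f w)%E ->
  (\int[mu]_w f (tau w) = \int[mu]_w f w)%E.
Proof.
move=> mf f0; have [mtau mutau] := htau.
have := @ge0_integral_pushforward _ _ T T R tau mtau mu [set: T] f measurableT mf.
rewrite preimage_setT => <-//.
by apply: eq_measure_integral => A mA _; exact: mutau.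
Qed.

Lemma measurable_iter i : measurable_fun [set: T] (iter i tau).
Proof.
elim: i => [|i IH]; first exact: measurable_id.
by apply: (@measurableT_comp _ _ _ _ _ _ tau) => //; exact: (proj1 htau).
Qed.

Definition birkhoff_avg (n : nat) (g : T -> R) (w : T) : R :=
  n%:R^-1 * \sum_(0 <= i < n) g (iter i tau w).

Lemma measurable_birkhoff_avg n g : measurable_fun [set: T] g ->
  measurable_fun [set: T] (birkhoff_avg n g).
Proof.
move=> mg; apply: measurable_funM => //.
apply: measurable_sum => i; apply: measurableT_comp => //.
exact: measurable_iter.
Qed.

(** The maximum of the ergodic sums of [h] of length 0 to [K], written through
    the recursion [S_(n+1) h = h + (S_n h) o tau] on which Hopf's argument
    rests. *)
Fixpoint hopf_max (h : T -> R) (K : nat) (w : T) : R :=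
  if K is K'.+1 then Num.max 0 (h w + hopf_max h K' (tau w)) else 0.

Lemma hopf_max_ge0 h K w : 0 <= hopf_max h K w.
Proof. by case: K => //= K; rewrite le_max lexx. Qed.

Lemma hopf_max_nd h K w : hopf_max h K w <= hopf_max h K.+1 w.
Proof.
elim: K w => [|K IH] w; first exact: (hopf_max_ge0 h 1).
by rewrite [in leLHS]/= ge_max hopf_max_ge0/= le_max lerD2l IH orbT.
Qed.

Lemma hopf_max_step h K w : 0 < hopf_max h K w ->
  hopf_max h K w <= h w + hopf_max h K (tau w).
Proof.
case: K => [|K]; first by rewrite ltxx.
rewrite [in X in X -> _]/= [leLHS]/= lt_max ltxx /= => h0.
by rewrite (max_r (ltW h0)) lerD2l hopf_max_nd.
Qed.

Lemma hopf_max_gt0 h K w : 0 < hopf_max h K w <->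
  exists2 n, (0 < n <= K)%N & 0 < \sum_(0 <= i < n) h (iter i tau w).
Proof.
have sumS n v : \sum_(0 <= i < n.+1) h (iter i tau v) =
    h v + \sum_(0 <= i < n) h (iter i tau (tau v)).
  by rewrite big_nat_recl//; congr (_ + _); apply: eq_bigr => i _; rewrite -iterSr.
split.
  have : exists2 n, (n <= K)%N & hopf_max h K w = \sum_(0 <= i < n) h (iter i tau w).
    elim: K w => [|K IH] w; first by exists 0 => //; rewrite big_geq.
    have [n nK E] := IH (tau w); rewrite /= E /Num.max; case: ltP => _.
      by exists n.+1 => //; rewrite sumS.
    by exists 0 => //; rewrite big_geq.
  move=> [[|n] nK ->]; first by rewrite big_geq// ltxx.
  by exists n.+1.
move=> [n /andP[_ nK]] /lt_le_trans; apply.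
elim: K n w nK => [|K IH] [|n] w nK //; first by rewrite big_geq.
  by rewrite big_geq// hopf_max_ge0.
by rewrite sumS /= le_max lerD2l IH ?orbT.
Qed.

Lemma measurable_hopf_max h K : measurable_fun [set: T] h ->
  measurable_fun [set: T] (hopf_max h K).
Proof.
move=> mh; elim: K => [|K IH] //=.
apply: measurable_maxr => //; apply: measurable_funD => //.
by apply: measurableT_comp => //; exact: (proj1 htau).
Qed.

(** Garsia's proof of Hopf's lemma.  Let [M] be the maximum of the sums of
    [h = g - l] of length at most [K]; the averages of [g] exceed [l] exactly on
    [A = {M > 0}].  There [M <= h + M o tau], and elsewhere [M = 0], hence
    [l 1_A + M <= g 1_A + M o tau].  Integrating, the two integrals of [M] cancel,
    as [tau] preserves the measure and [M] is integrable. *)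
Lemma maximal_ergodic (g : T -> R) (l : R) (K : nat) :
  measurable_fun [set: T] g -> (forall w, 0 <= g w) ->
  (\int[mu]_w (g w)%:E < +oo)%E -> 0 < l ->
  (l%:E * mu [set w | (l < runmax (fun n => birkhoff_avg n.+1 g) K w)%R] <=
   \int[mu]_(w in [set w | (l < runmax (fun n => birkhoff_avg n.+1 g) K w)%R]) (g w)%:E)%E.
Proof.
move=> mg g0 Ig l0.
pose h w := g w - l.
have mh : measurable_fun [set: T] h by exact: measurable_funB.
pose M K w := hopf_max h K w.
have mM k : measurable_fun [set: T] (M k) by exact: measurable_hopf_max.
have -> : [set w | l < runmax (fun n => birkhoff_avg n.+1 g) K w] =
    [set w | 0 < M K w].
  have sumE n w : (l < birkhoff_avg n.+1 g w) =
      (0 < \sum_(0 <= i < n.+1) h (iter i tau w)).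
    rewrite /birkhoff_avg mulrC ltr_pdivlMr// /h sumrB subr_gt0.
    by rewrite sumr_const_nat subn0 mulr_natr.
  apply/seteqP; split => w /=.
    move=> /(runmax_gtP _ _ _ (ltW l0))[n nK]; rewrite sumE => H.
    by apply/hopf_max_gt0; exists n.+1.
  move=> /hopf_max_gt0[[//|n] /= nK]; rewrite -sumE => H.
  by apply/(runmax_gtP _ _ _ (ltW l0)); exists n.
set A := [set w | _].
have mA : measurable A by exact: measurable_gt.
have MI k : (\int[mu]_w (M k w)%:E < +oo)%E.
  elim: k => [|k IH]; first by rewrite integral0_eq.
  apply: (@le_lt_trans _ _ (\int[mu]_w ((g w)%:E + (M k (tau w))%:E))%E).
    apply: ge0_le_integral => //.
    - by move=> w _; rewrite lee_fin hopf_max_ge0.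
    - exact/measurable_EFinP.
    - apply: emeasurable_funD; apply/measurable_EFinP => //.
      by apply: measurableT_comp => //; exact: (proj1 htau).
    - move=> w _; rewrite -EFinD lee_fin /M/= ge_max addr_ge0 ?hopf_max_ge0//=.
      by rewrite lerD2r /h gerBl ltW.
  rewrite ge0_integralD//; last 4 first.
  - by move=> w _; rewrite lee_fin.
  - exact/measurable_EFinP.
  - by move=> w _; rewrite lee_fin hopf_max_ge0.
  - apply/measurable_EFinP; apply: measurableT_comp => //; exact: (proj1 htau).
  apply: lte_add_pinfty => //.
  rewrite (@ge0_integral_preserving (EFin \o M k))//; first exact/measurable_EFinP.
  by move=> w; rewrite lee_fin hopf_max_ge0.
have M0 : (0 <= \int[mu]_w (M K w)%:E)%E.
  by apply: integral_ge0 => w _; rewrite lee_fin hopf_max_ge0.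
have Mfin : (\int[mu]_w (M K w)%:E)%E \is a fin_num by rewrite ge0_fin_numE.
rewrite -(leeD2rE _ _ Mfin).
rewrite -integral_cst// [X in (X + _ <= _)%E]integral_mkcond.
rewrite [X in (_ <= X + _)%E]integral_mkcond.
rewrite -[X in (_ <= _ + X)%E](@ge0_integral_preserving (EFin \o M K))//; last 2 first.
- exact/measurable_EFinP.
- by move=> w; rewrite lee_fin hopf_max_ge0.
have mMt : measurable_fun [set: T] (fun w => (EFin \o M K) (tau w)).
  apply/measurable_EFinP; apply: measurableT_comp => //; exact: (proj1 htau).
have mgA : measurable_fun [set: T] ((fun w => (g w)%:E) \_ A).
  apply: (proj1 (measurable_restrictT _ _)) => //.
  by apply/measurable_EFinP; exact: measurable_funTS.
have mlA : measurable_fun [set: T] ((cst l%:E : T -> \bar R) \_ A).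
  exact: (proj1 (measurable_restrictT _ _)).
rewrite -!ge0_integralD//.
- apply: ge0_le_integral => //.
  + move=> w _; rewrite adde_ge0 ?lee_fin ?hopf_max_ge0//.
    by rewrite patchE; case: ifP => //; rewrite lee_fin ltW.
  + by apply: emeasurable_funD => //; exact/measurable_EFinP.
  + exact: emeasurable_funD.
  + move=> w _; rewrite !patchE /=.
    have -> : (w \in A) = (0 < M K w) by apply/idP/idP; rewrite inE.
    case: ltP => Mw.
      rewrite -!EFinD lee_fin.
      by have := hopf_max_step Mw; rewrite -/(M K w) -/(M K (tau w)) /h; lra.
    by rewrite !add0e lee_fin (le_trans Mw)// hopf_max_ge0.
- by move=> w _; rewrite patchE; case: ifP => //; rewrite lee_fin.
- by move=> w _ /=; rewrite lee_fin hopf_max_ge0.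
- by move=> w _; rewrite patchE; case: ifP => //; rewrite lee_fin ltW.
- by move=> w _ /=; rewrite lee_fin hopf_max_ge0.
- exact/measurable_EFinP.
Qed.

End hopf.

(** * Doob's maximal inequality for finite sequences *)

Section doob.
Context d (T : measurableType d) (R : realType).
Variable mu : {finite_measure set T -> \bar R}.

(** Makes measurability with respect to [F] an instance of measurability on a
    measurable type, so that the general closure properties apply to it. *)
Lemma sub_sigma_algebraE (F : set (set T)) : sub_sigma_algebra_of F ->
  F = (@measurable _ (g_sigma_algebraType F)).
Proof. by move=> [sF _]; rewrite /measurable/= sigma_algebra_id. Qed.

(** Doob's stopping argument, as an induction on the number of terms.  On the part
    of [B] where [a 0] exceeds [l], a set of [F 0], the inequality is Chebyshev's
    followed by the domination of [a 0] by [b]; the remaining part of [B] belongs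
    to [F 0], hence to [F 1], and the induction hypothesis applies there to the
    shifted sequence. *)
Lemma maximal_submartingale_in (F : nat -> set (set T)) (a : nat -> T -> R)
    (b : T -> R) (l : R) (K : nat) (B : set T) :
  (forall n, sub_sigma_algebra_of (F n)) ->
  (forall n, F n `<=` F n.+1) ->
  (forall n, F n [set w | l < a n w]) ->
  (forall n, measurable_fun [set: T] (a n)) ->
  (forall n w, 0 <= a n w) ->
  measurable_fun [set: T] b -> (forall w, 0 <= b w) ->
  (forall n A, F n A -> \int[mu]_(w in A) (a n w)%:E <= \int[mu]_(w in A) (b w)%:E)%E ->
  0 < l -> F 0 B ->
  (l%:E * mu (B `&` [set w | (l < runmax a K w)%R]) <=
   \int[mu]_(w in B `&` [set w | (l < runmax a K w)%R]) (b w)%:E)%E.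
Proof.
move=> + + + + + mb b0 + l0; elim: K F a B => [|K IH] F a B sF Fnd Fa ma a0 ab FB.
  rewrite (_ : _ `&` _ = set0) ?measure0 ?mule0 ?integral_set0//.
  by apply/seteqP; split=> // w [_ /= /(runmax_gtP _ _ _ (ltW l0))[]].
have Fm n A : F n A -> measurable A by exact: (proj2 (sF n)).
have FI : F 0 (B `&` [set w | l < a 0 w]).
  move: FB (Fa 0); rewrite (sub_sigma_algebraE (sF 0)); exact: measurableI.
have FD : F 1 (B `\` [set w | l < a 0 w]).
  apply: Fnd; move: FB (Fa 0); rewrite (sub_sigma_algebraE (sF 0)).
  exact: measurableD.
have := IH (fun n => F n.+1) (fun n => a n.+1) _ (fun n => sF n.+1)
  (fun n => Fnd n.+1) (fun n => Fa n.+1) (fun n => ma n.+1)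
  (fun n => a0 n.+1) (fun n => ab n.+1) FD.
set D := _ `&` [set w | l < runmax _ K w].
set C := B `&` [set w | l < a 0 w] in FI *.
have -> : B `&` [set w | l < runmax a K.+1 w] = C `|` D.
  apply/seteqP; split=> w.
    move=> [Bw /= /(runmax_gtP _ _ _ (ltW l0))[k kK lk]].
    case: (ltP l (a 0 w)) => la0; first by left.
    right; split; first by split=> //=; apply/negP; rewrite -leNgt.
    case: k kK lk => [|k kK lk]; first by rewrite ltNge la0.
    by apply/(runmax_gtP _ _ _ (ltW l0)); exists k.
  move=> [[Bw /= la]|[[Bw _] /= /(runmax_gtP _ _ _ (ltW l0))[k kK lk]]]; split=> //=.
    by apply/(runmax_gtP _ _ _ (ltW l0)); exists 0.
  by apply/(runmax_gtP _ _ _ (ltW l0)); exists k.+1.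
move=> HD.
have mC : measurable C by exact: Fm FI.
have mD : measurable D.
  apply: measurableI; first exact: Fm FD.
  by apply: measurable_gt; exact: measurable_runmax.
have CD0 : C `&` D = set0.
  by apply/seteqP; split=> // w [[_ /= la] [[_ nla] _]].
rewrite measureU// ge0_integral_setU//; last 3 first.
- by apply/measurable_EFinP; exact: measurable_funTS.
- by move=> w _; rewrite lee_fin.
- by apply/disj_setPS; rewrite CD0.
rewrite ge0_muleDr//; apply: leeD => //.
apply: (le_trans _ (ab 0 C FI)).
rewrite -integral_cst//; apply: ge0_le_integral => //.
- by move=> w _; rewrite lee_fin ltW.
- by apply/measurable_EFinP; exact: measurable_funTS.
- by move=> w [_ /= la]; rewrite lee_fin ltW.
Qed.

(** Reversing the order of the first [K] terms turns a decreasing sequence of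
    sigma-algebras into an increasing one. *)
Lemma runmax_rev_gt (a : nat -> T -> R) (K : nat) (l : R) : 0 <= l ->
  [set w | l < runmax (fun k => a (K - k.+1)%N) K w] = [set w | l < runmax a K w].
Proof.
move=> l0; apply/seteqP; split=> w /=; move=> /(runmax_gtP _ _ _ l0)[k kK lk];
  apply/(runmax_gtP _ _ _ l0).
- by exists (K - k.+1)%N => //; rewrite ltn_subrL (leq_ltn_trans _ kK).
- exists (K - k.+1)%N; first by rewrite ltn_subrL (leq_ltn_trans _ kK).
  by rewrite subnSK ?subKn// ltnW.
Qed.

End doob.

(** * Strongly measurable functions *)

Section strong_measurability.
Context d (T : measurableType d) (R : realType) (X : normedModType R).

Local Notation sm := (@strongly_measurable T R X measurable).

Lemma simple_fun_preimage (s : T -> X) (B : set X) :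
  simple_fun measurable s -> measurable (s @^-1` B).
Proof.
move=> [fs ms].
rewrite (_ : s @^-1` B = \bigcup_(y in range s `&` B) s @^-1` [set y]).
  by apply: fin_bigcup_measurable => //; exact: finite_setIl.
apply/seteqP; split=> w /=; last by move=> [y [_ By] /= ->].
by move=> Bsw; exists (s w) => //; split=> //; exists w.
Qed.

Lemma simple_fun_comp2 (op : X -> X -> X) (s t : T -> X) :
  simple_fun measurable s -> simple_fun measurable t ->
  simple_fun measurable (fun w => op (s w) (t w)).
Proof.
move=> ss st; split.
  apply: (@sub_finite_set _ _ [set op y z | y in range s & z in range t]).
    by move=> _ [w _ <-] /=; exists (s w); [exists w|exists (t w) => //; exists w].
  by apply: finite_image2; [exact: (proj1 ss)|exact: (proj1 st)].
move=> x.
rewrite (_ : _ @^-1` _ = \bigcup_(y in range s)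
    (s @^-1` [set y] `&` t @^-1` [set z | op y z = x])).
  apply: fin_bigcup_measurable; first exact: (proj1 ss).
  by move=> y _; apply: measurableI; [exact: (proj2 ss)|exact: simple_fun_preimage].
apply/seteqP; split=> w /=; last by move=> [y _ [/= -> ]].
by move=> <-; exists (s w) => //; exists w.
Qed.

Lemma measurable_simple_fun (h : X -> R) (s : T -> X) :
  simple_fun measurable s -> measurable_fun [set: T] (h \o s).
Proof.
move=> ss _ B mB; rewrite setTI comp_preimage; exact: simple_fun_preimage.
Qed.

Lemma simple_fun_cst (x : X) : simple_fun measurable (fun _ : T => x).
Proof.
split; first by apply: (sub_finite_set _ (finite_set1 x)) => _ [w _ <-].
by move=> y; rewrite preimage_cst; case: ifP.
Qed.

Lemma strongly_measurable_simple (s : T -> X) :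
  simple_fun measurable s -> sm s.
Proof. by move=> ss; exists (fun=> s) => // w; exact: cvg_cst. Qed.

Lemma strongly_measurableD (f g : T -> X) : sm f -> sm g ->
  sm (fun w => f w + g w).
Proof.
move=> [s ss sf] [t st tg]; exists (fun n w => s n w + t n w).
  by move=> n; exact: (simple_fun_comp2 (fun x y => x + y)).
by move=> w; apply: cvgD; [exact: sf|exact: tg].
Qed.

Lemma strongly_measurableZ (k : R) (f : T -> X) : sm f ->
  sm (fun w => k *: f w).
Proof.
move=> [s ss sf]; exists (fun n w => k *: s n w).
  by move=> n; exact: (simple_fun_comp2 (fun x y => k *: x) (ss n) (ss n)).
by move=> w; apply: cvgZr; exact: sf.
Qed.

Lemma strongly_measurable_sum (f : nat -> T -> X) (n : nat) :
  (forall i, sm (f i)) -> sm (fun w => \sum_(0 <= i < n) f i w).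
Proof.
move=> mf; elim: n => [|n IH].
  rewrite (_ : (fun _ => _) = fun=> 0).
    by apply: strongly_measurable_simple; exact: simple_fun_cst.
  by apply/funext => w; rewrite big_geq.
rewrite (_ : (fun _ => _) = fun w => \sum_(0 <= i < n) f i w + f n w).
  exact: strongly_measurableD.
by apply/funext => w; rewrite big_nat_recr.
Qed.

Lemma strongly_measurable_comp (tau : T -> T) (f : T -> X) :
  measurable_fun [set: T] tau -> sm f -> sm (f \o tau).
Proof.
move=> mtau [s ss sf]; exists (fun n => s n \o tau); last by move=> w; exact: sf.
move=> n; split.
  by apply: (sub_finite_set _ (proj1 (ss n))) => _ [w _ <-] /=; exists (tau w).
by move=> x; rewrite comp_preimage -[X in measurable X]setTI; apply: mtau => //;
  exact: (proj2 (ss n)).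
Qed.

Lemma measurable_norm_strongly_measurable (f : T -> X) :
  sm f -> measurable_fun [set: T] (fun w => `|f w|).
Proof.
move=> [s ss sf].
apply: (@measurable_fun_cvg _ _ _ _ (fun n w => `|s n w|)) => //.
  by move=> n; exact: (measurable_simple_fun (fun x => `|x|)).
by move=> w _; apply: cvg_norm; exact: sf.
Qed.

Lemma measurable_normB_strongly_measurable (f s : T -> X) :
  sm f -> simple_fun measurable s -> measurable_fun [set: T] (fun w => `|f w - s w|).
Proof.
move=> mf ss; apply: measurable_norm_strongly_measurable.
apply: strongly_measurableD => //; apply: strongly_measurable_simple.
exact: (simple_fun_comp2 (fun x y => - x) ss ss).
Qed.

End strong_measurability.

(** * Bochner integrals and conditional expectations *)

Section bochner.
Context d (T : measurableType d) (R : realType) (X : normedModType R).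
Variable mu : {finite_measure set T -> \bar R}.

Lemma integral_simple_partition (s : T -> X) (A : set T) (h : T -> \bar R) :
  simple_fun measurable s -> measurable A ->
  measurable_fun [set: T] h -> (forall w, 0 <= h w)%E ->
  (\int[mu]_(w in A) h w =
   \sum_(y <- fset_set (range s)) \int[mu]_(w in A `&` s @^-1` [set y]) h w)%E.
Proof.
move=> ss mA mh h0.
have mAs y : measurable (A `&` s @^-1` [set y]).
  by apply: measurableI => //; exact: (proj2 ss).
have E : \big[setU/set0]_(y <- fset_set (range s)) (A `&` s @^-1` [set y]) = A.
  rewrite bigsetU_fset_set; last exact: (proj1 ss).
  apply/seteqP; split=> w; first by move=> [y _ []].
  by move=> Aw; exists (s w) => //; exists w.
rewrite -{1}E; apply: ge0_integral_bigsetU => //.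
- apply/trivIsetP => y z _ _ /eqP yz; apply/seteqP; split=> // w.
  by move=> [[_ /= swy] [_ /= swz]]; apply: yz; rewrite -swy -swz.
- exact: measurable_funTS.
Qed.

Lemma simple_integral_dist (s : T -> X) (A : set T) (x : X) :
  simple_fun measurable s -> measurable A ->
  ((`|simple_integral mu A s - fine (mu A) *: x|)%:E <=
   \int[mu]_(w in A) (`|s w - x|)%:E)%E.
Proof.
move=> ss mA.
have mAs y : measurable (A `&` s @^-1` [set y]).
  by apply: measurableI => //; exact: (proj2 ss).
have muA : fine (mu A) = \sum_(y <- fset_set (range s)) fine (mu (A `&` s @^-1` [set y])).
  have := integral_simple_partition ss mA (@measurable_cst _ _ T _ setT (1%:E : \bar R)) (fun=> lee01).
  rewrite integral_cst// mul1e => ->.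
  rewrite -sum_fine; last by move=> y _; rewrite integral_cst// mul1e fin_num_mu.
  by apply: eq_bigr => y _; rewrite integral_cst// mul1e.
rewrite /simple_integral fsbig_finite/=; last exact: (proj1 ss).
rewrite muA scaler_suml -sumrB.
apply: (@le_trans _ _ (\sum_(y <- fset_set (range s))
    fine (mu (A `&` s @^-1` [set y])) * `|y - x|)%:E).
  rewrite lee_fin; apply: (le_trans (ler_norm_sum _ _ _)).
  apply: ler_sum => y _; rewrite -scalerBr normrZ ger0_norm//.
  exact: fine_ge0.
have msx : measurable_fun [set: T] (fun w => (`|s w - x|)%:E).
  by apply/measurable_EFinP; exact: (measurable_simple_fun (fun y => `|y - x|)).
rewrite (integral_simple_partition ss mA msx)//.
rewrite -sumEFin; apply: lee_sum => y _.
rewrite EFinM fineK ?fin_num_mu// muleC -integral_cst//.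
rewrite le_eqVlt; apply/orP; left; apply/eqP/eq_integral => w.
by rewrite inE => -[_ /= ->].
Qed.

(** The integral over [A] stays as close to that of the constant [x] as the
    integrand does in mean.  With [x = 0] this is the triangle inequality for the
    Bochner integral. *)
Lemma bochner_integral_dist (f : T -> X) (A : set T) (v x : X) :
  strongly_measurable measurable f -> measurable A ->
  is_bochner_integral mu A f v ->
  ((`|v - fine (mu A) *: x|)%:E <= \int[mu]_(w in A) (`|f w - x|)%:E)%E.
Proof.
move=> mf mA [s [ss fs sv]].
have mfx : measurable_fun [set: T] (fun w => (`|f w - x|)%:E).
  apply/measurable_EFinP; apply: (measurable_normB_strongly_measurable mf).
  exact: simple_fun_cst.
have mfs n : measurable_fun [set: T] (fun w => (`|f w - s n w|)%:E).
  by apply/measurable_EFinP; exact: measurable_normB_strongly_measurable.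
have bnd n : ((`|v - fine (mu A) *: x|)%:E <= (`|v - simple_integral mu A (s n)|)%:E +
    (\int[mu]_(w in A) (`|f w - x|)%:E + \int[mu]_(w in A) (`|f w - s n w|)%:E))%E.
  apply: (@le_trans _ _ ((`|v - simple_integral mu A (s n)|)%:E +
      (`|simple_integral mu A (s n) - fine (mu A) *: x|)%:E)%E).
    by rewrite -EFinD lee_fin ler_distD.
  apply: leeD => //; apply: (le_trans (simple_integral_dist x (ss n) mA)).
  rewrite -ge0_integralD//; [|exact: measurable_funTS..].
  apply: ge0_le_integral => //.
  - apply: measurable_funTS; apply/measurable_EFinP.
    exact: (measurable_simple_fun (fun y => `|y - x|)).
  - by apply: emeasurable_funD; exact: measurable_funTS.
  - move=> w _; rewrite -EFinD lee_fin [leRHS]addrC (distrC (f w) (s n w)).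
    exact: ler_distD.
set I := (\int[mu]_(w in A) (`|f w - x|)%:E)%E in bnd *.
have cvr : ((`|v - simple_integral mu A (s n)|)%:E +
    (I + \int[mu]_(w in A) (`|f w - s n w|)%:E))%E @[n --> \oo] --> I.
  have hI : (0%:E + (I + 0))%E = I by rewrite add0e adde0.
  rewrite -[X in _ --> X]hI; apply: cvgeD; first by [].
    apply/fine_cvgP; split; first exact: nearW.
    by have := cvg_norm (cvgB (cvg_cst v) sv); rewrite subrr normr0; apply.
  apply: cvgeD; [|exact: cvg_cst|exact: fs].
  by rewrite fin_num_adde_defl.
rewrite -(cvg_lim _ cvr)//.
apply: lime_ge; first by apply/cvg_ex; eexists; exact: cvr.
by apply: nearW.
Qed.

(** Conditional expectations contract the norm on each set of [F].  Cut such a set,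
    except for a part that vanishes in the limit, into pieces belonging to [F] on
    each of which [g] is within [c] of a value [y] of an [F]-simple function.  On a piece [C] the integral of the norm of [g]
    is, up to [c * mu C], the norm of [mu C *: y], hence up to [2 * c * mu C] the
    norm of the integral of [g] over [C]; that integral equals the one of [f].
    This direct argument replaces the conditional Jensen inequality. *)
Lemma cond_exp_contraction (F : set (set T)) (f g : T -> X) (A : set T) :
  sub_sigma_algebra_of F -> strongly_measurable measurable f ->
  is_cond_exp mu F f g -> F A ->
  (\int[mu]_(w in A) (`|g w|)%:E <= \int[mu]_(w in A) (`|f w|)%:E)%E.
Proof.
move=> sF mf [[s ss sg] [mg _] Efg] FA.
have Fm := proj2 sF.
have FE := sub_sigma_algebraE sF.
have mA : measurable A by exact: Fm.
have msn n : simple_fun measurable (s n).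
  by split; [exact: (proj1 (ss n))|move=> x; apply: Fm; exact: (proj2 (ss n))].
have mnf : measurable_fun [set: T] (fun w => (`|f w|)%:E).
  by apply/measurable_EFinP; exact: measurable_norm_strongly_measurable.
have mng : measurable_fun [set: T] (fun w => (`|g w|)%:E).
  by apply/measurable_EFinP; exact: measurable_norm_strongly_measurable.
apply/lee_addgt0Pr => e e0.
set m := fine (mu A).
have m0 : 0 <= m by exact: fine_ge0.
(* so that 2 * c * m <= e *)
pose c := e / (2 * (m + 1)).
have m1 : 0 < m + 1 by rewrite ltr_wpDl.
have c0 : 0 < c by rewrite divr_gt0// mulr_gt0.
(* on D N the approximation of g by s N is uniform, and the D N exhaust A *)
pose D N := A `&` \bigcap_(n in [set n | (N <= n)%N]) [set w | `|g w - s n w| < c].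
have FD N : F (D N).
  rewrite /D; move: FA; rewrite FE => FA; apply: measurableI => //.
  apply: bigcap_measurable; first by exists N => /=.
  move=> n _.
  rewrite -[X in measurable X]setTI.
  rewrite (_ : [set w | _] = (fun w => `|g w - s n w|) @^-1` `]-oo, c[%classic).
    apply: (@measurable_normB_strongly_measurable _ (g_sigma_algebraType F)) => //.
      by exists s => //; rewrite -FE.
    by rewrite -FE.
  by apply/seteqP; split => w /=; rewrite in_itv/=.
have UD : \bigcup_N D N = A.
  apply/seteqP; split=> w; first by move=> [N _ []].
  move=> Aw; have /cvgrPdist_lt/(_ c c0)[N _ HN] := sg w.
  by exists N => //; split=> // n /= Nn; exact: HN.
have mD N : measurable (D N) by exact: Fm.
have mfc : measurable_fun [set: T] (fun w => (`|f w|)%:E + (2 * c)%:E)%E.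
  exact: emeasurable_funD.
have bnd N : (\int[mu]_(w in D N) (`|g w|)%:E <=
    \int[mu]_(w in D N) ((`|f w|)%:E + (2 * c)%:E))%E.
  rewrite (integral_simple_partition (msn N) (mD N) mng)//.
  rewrite (integral_simple_partition (msn N) (mD N) mfc); last first.
    by move=> w; rewrite -EFinD lee_fin addr_ge0// mulr_ge0// ltW.
  apply: lee_sum => y _.
  set C := D N `&` _.
  have FC : F C.
    move: (FD N) (proj2 (ss N) y); rewrite FE; exact: measurableI.
  have mC : measurable C by exact: Fm.
  have CE w : C w -> `|g w - y| < c.
    by move=> [[_ Dw] /= <-]; exact: (Dw N (leqnn N)).
  have [v vf vg] := Efg C FC.
  have muC : mu C = (fine (mu C))%:E by rewrite fineK// fin_num_mu.
  have hf := bochner_integral_dist 0 mf mC vf.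
  have hg := bochner_integral_dist y mg mC vg.
  rewrite scaler0 subr0 in hf.
  have hf' : ((`|v|)%:E <= \int[mu]_(w in C) (`|f w|)%:E)%E.
    by apply: (le_trans hf); under eq_integral do rewrite subr0.
  have hg' : ((`|v - fine (mu C) *: y|)%:E <= (c * fine (mu C))%:E)%E.
    apply: (le_trans hg).
    apply: (@le_trans _ _ (\int[mu]_(w in C) (cst c%:E w))%E).
      apply: ge0_le_integral => //.
      - apply/measurable_EFinP; apply: measurable_funTS.
        apply: (measurable_normB_strongly_measurable mg); exact: simple_fun_cst.
      - by move=> w /CE/ltW; rewrite lee_fin.
    rewrite integral_cst// [X in (_ * X <= _)%E](_ : _ = (fine (mu C))%:E).
      by rewrite -EFinM.
    exact: muC.
  apply: (@le_trans _ _ (\int[mu]_(w in C) (cst (`|y| + c)%:E w))%E).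
    apply: ge0_le_integral => //.
    - exact: measurable_funTS.
    - move=> w /CE/ltW gy; rewrite lee_fin.
      by rewrite -lerBlDl; apply: le_trans gy; rewrite (le_trans _ (ler_dist_dist _ _))// ler_norm.
  rewrite integral_cst// [X in (_ * X)%E](_ : _ = (fine (mu C))%:E); last exact: muC.
  rewrite ge0_integralD//; last 2 first.
  - exact: measurable_funTS.
  - by move=> w _; rewrite lee_fin mulr_ge0// ltW.
  rewrite integral_cst// [X in (_ <= _ + _ * X)%E](_ : _ = (fine (mu C))%:E); last exact: muC.
  apply: (le_trans _ (leeD hf' (le_refl _))).
  rewrite -!EFinM -EFinD lee_fin.
  have muC0 : 0 <= fine (mu C) by exact: fine_ge0.
  have h1 : `|fine (mu C) *: y| <= `|v| + `|v - fine (mu C) *: y|.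
    by have := ler_normB v (v - fine (mu C) *: y); rewrite subKr.
  rewrite normrZ ger0_norm// in h1.
  rewrite lee_fin in hg'.
  by nra.
rewrite -UD; apply: integral_le_bigcup => //.
- apply/nondecreasing_seqP => N; apply/subsetPset => w [Aw Dw]; split=> // n /= Nn.
  by apply: Dw => /=; exact: ltnW.
- exact: measurable_funTS.
- move=> N; apply: (le_trans (bnd N)).
  apply: (@le_trans _ _ (\int[mu]_(w in A) ((`|f w|)%:E + (2 * c)%:E))%E).
    apply: ge0_subset_integral => //.
    + exact: measurable_funTS.
    + by move=> w _; rewrite -EFinD lee_fin addr_ge0// mulr_ge0// ltW.
    + by move=> w [].
  rewrite ge0_integralD//; last 2 first.
  - exact: measurable_funTS.
  - by move=> w _; rewrite lee_fin mulr_ge0// ltW.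
  rewrite UD; apply: leeD => //.
  rewrite integral_cst// [X in (_ * X)%E](_ : _ = m%:E); last first.
    by rewrite fineK// fin_num_mu.
  rewrite -EFinM lee_fin /c (_ : _ * m = e * (m / (m + 1))); last first.
    by field; rewrite gt_eqF.
  by rewrite ger_pMr// ler_pdivrMr// mul1r lerDl.
Qed.

End bochner.

(** * Suprema of sequences of maximal functions *)

Section supseq.
Context d (T : measurableType d) (R : realType).
Variable mu : {finite_measure set T -> \bar R}.

Definition supseq (u : nat -> T -> R) (w : T) : \bar R :=
  ereal_sup (range (fun K => (u K w)%:E)).

Lemma supseq_ge u K w : ((u K w)%:E <= supseq u w)%E.
Proof. by apply: ereal_sup_ubound; exists K. Qed.

Lemma supseq_gtP u w (l : R) : (l%:E < supseq u w)%E <-> exists K, l < u K w.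
Proof.
split=> [/ereal_sup_gt[_ [K _ <-]]|[K lK]]; first by rewrite lte_fin; exists K.
by apply: lt_le_trans (supseq_ge u K w); rewrite lte_fin.
Qed.

Lemma le_supseq (u v : nat -> T -> R) w :
  (forall K, u K w <= v K w) -> (supseq u w <= supseq v w)%E.
Proof.
move=> uv; apply: ge_ereal_sup => _ [K _ <-].
by apply: le_trans (supseq_ge v K w); rewrite lee_fin.
Qed.

Lemma measurable_supseq (u : nat -> T -> R) : (forall w, nondecreasing_seq (u ^~ w)) ->
  (forall K, measurable_fun [set: T] (u K)) ->
  measurable_fun [set: T] (supseq u).
Proof.
move=> ndu mu'; apply: (@emeasurable_fun_cvg _ _ _ _ (fun K w => (u K w)%:E)) => //.
  by move=> K; exact/measurable_EFinP.
move=> w _; apply: ereal_nondecreasing_cvgn => m n mn.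
by rewrite lee_fin; exact: ndu.
Qed.

(** The level sets of the supremum are the increasing unions of those of the
    [u K], so that the inequality passes to the limit on sets. *)
Lemma weak_maximal_supseq (f : T -> \bar R) (u : nat -> T -> R) :
  (forall w, nondecreasing_seq (u ^~ w)) ->
  (forall K, measurable_fun [set: T] (u K)) ->
  measurable_fun [set: T] f -> (forall w, 0 <= f w)%E ->
  (forall K l, (0 < l)%R -> l%:E * mu [set w | (l < u K w)%R] <=
     \int[mu]_(w in [set w | (l < u K w)%R]) f w)%E ->
  weak_maximal mu f (supseq u).
Proof.
move=> ndu mfu mf f0 H l l0.
have mA K : measurable [set w | l < u K w] by exact: measurable_gt.
have -> : [set w | (l%:E < supseq u w)%E] = \bigcup_K [set w | l < u K w].
  apply/seteqP; split=> w /=.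
    by move=> /supseq_gtP[K lK]; exists K.
  by move=> [K _ /= lK]; apply/supseq_gtP; exists K.
rewrite -integral_cst; last exact: bigcup_measurable.
apply: integral_le_bigcup => //.
- apply/nondecreasing_seqP => K; apply/subsetPset => w /= lK.
  by apply: (lt_le_trans lK); apply: ndu.
- by move=> w _; rewrite lee_fin ltW.
- move=> K; rewrite integral_cst//; apply: (le_trans (H K l l0)).
  apply: ge0_subset_integral => //; first exact: bigcup_measurable.
  + exact: measurable_funTS.
  + exact: (@bigcup_sup _ _ K).
Qed.

(** By the weak-type inequality the set where [g] is infinite has measure at most
    the integral of [f] divided by [l], for every [l]. *)
Lemma weak_maximal_fin (f g : T -> \bar R) :
  measurable_fun [set: T] f -> measurable_fun [set: T] g ->
  (forall w, 0 <= f w)%E -> (forall w, 0 <= g w)%E ->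
  (\int[mu]_w f w < +oo)%E -> weak_maximal mu f g ->
  {ae mu, forall w, g w = (fine (g w))%:E}.
Proof.
move=> mf mg f0 g0 If wfg.
have mN : measurable [set w | g w = +oo%E].
  rewrite -[X in measurable X]setTI; exact: (mg measurableT [set +oo%E] (emeasurable_set1 _)).
exists [set w | g w = +oo%E]; split=> //; last first.
  move=> w /= gw; apply/eqP; move: gw; apply: contra_notT => gy.
  by rewrite fineK// ge0_fin_numE// ltey.
apply/eqP; rewrite eq_le measure_ge0 andbT.
apply/lee_addgt0Pr => e e0; rewrite add0e.
have I0 : (0 <= \int[mu]_w f w)%E by exact: integral_ge0.
pose c := fine (\int[mu]_w f w)%E.
have c0 : 0 <= c by exact: fine_ge0.
have cE : (\int[mu]_w f w = c%:E)%E by rewrite fineK// ge0_fin_numE.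
(* so that c / l <= e *)
pose l := (c + 1) / e.
have l0 : 0 < l by rewrite divr_gt0// ltr_wpDl.
have mA : measurable [set w | (l%:E < g w)%E].
  rewrite -[X in measurable X]setTI; exact: emeasurable_fun_o_infty.
have h : (l%:E * mu [set w | g w = +oo%E] <= c%:E)%E.
  apply: (@le_trans _ _ (l%:E * mu [set w | (l%:E < g w)%E])%E).
    apply: lee_wpmul2l; first by rewrite lee_fin ltW.
    by apply: le_measure; rewrite ?inE// => w /= ->; rewrite ltry.
  apply: (le_trans (wfg l l0)); rewrite -cE.
  by apply: ge0_subset_integral.
have muN : mu [set w | g w = +oo%E] \is a fin_num by exact: fin_num_mu.
rewrite -(fineK muN) -EFinM lee_fin in h *.
rewrite lee_fin -(ler_pM2l l0); apply: (le_trans h).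
by rewrite /l divfK ?gt_eqF// lerDl.
Qed.

Lemma weak_maximal_ae (f f' g g' : T -> \bar R) :
  measurable_fun [set: T] f -> measurable_fun [set: T] g ->
  measurable_fun [set: T] f' -> measurable_fun [set: T] g' ->
  (forall w, 0 <= f w)%E -> (forall w, 0 <= f' w)%E ->
  {ae mu, forall w, f w = f' w} -> {ae mu, forall w, g w = g' w} ->
  weak_maximal mu f g -> weak_maximal mu f' g'.
Proof.
move=> mf mg mf' mg' f0 f'0 ff' gg' wfg l l0.
have mA : measurable [set w | (l%:E < g w)%E].
  by rewrite -[X in measurable X]setTI; exact: emeasurable_fun_o_infty.
have mA' : measurable [set w | (l%:E < g' w)%E].
  by rewrite -[X in measurable X]setTI; exact: emeasurable_fun_o_infty.
have E (h h' : T -> \bar R) : measurable_fun [set: T] h -> measurable_fun [set: T] h' ->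
    (forall w, 0 <= h w)%E -> (forall w, 0 <= h' w)%E ->
    {ae mu, forall w, h w = h' w} ->
    (\int[mu]_(w in [set w | (l%:E < g w)%E]) h w =
     \int[mu]_(w in [set w | (l%:E < g' w)%E]) h' w)%E.
  move=> mh mh' h0 h'0 hh'.
  rewrite integral_mkcond [RHS]integral_mkcond; apply: ge0_ae_eq_integral => //.
  - by apply: (proj1 (measurable_restrictT _ _)) => //; exact: measurable_funTS.
  - by apply: (proj1 (measurable_restrictT _ _)) => //; exact: measurable_funTS.
  - by move=> w _; rewrite patchE; case: ifP.
  - by move=> w _; rewrite patchE; case: ifP.
  - apply: filterS2 gg' hh' => w ggw hhw _; rewrite !patchE hhw.
    have -> : (w \in [set w | (l%:E < g w)%E]) = (l%:E < g w)%E.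
      by apply/idP/idP; rewrite inE.
    have -> : (w \in [set w | (l%:E < g' w)%E]) = (l%:E < g' w)%E.
      by apply/idP/idP; rewrite inE.
    by rewrite ggw.
rewrite -(E f f')//; apply: le_trans (wfg l l0).
rewrite -integral_cst// -[in leRHS]integral_cst//.
rewrite (E (cst l%:E) (cst l%:E))//; last exact: nearW.
- by move=> w; rewrite lee_fin ltW.
- by move=> w; rewrite lee_fin ltW.
Qed.

End supseq.

Section real_valued.
Import HBSimple.

Lemma strongly_measurable_real d (T : measurableType d) (R : realType) (h : T -> R) :
  measurable_fun [set: T] h ->
  @strongly_measurable T R R^o measurable h.
Proof.
move=> mh; have mEh : measurable_fun [set: T] (EFin \o h) by exact/measurable_EFinP.
have [s sh] := approximation_sfun measurableT mEh.
exists (fun n w => (s n w : R^o)).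
  move=> n; split; first exact: fimfunP.
  by move=> x; rewrite -[X in measurable X]setTI; exact: measurable_funP.
by move=> w; have /fine_cvgP[_] := sh w I.
Qed.

End real_valued.

(** * The two maximal functions combined *)

Section assembly.
Context d (T : measurableType d) (R : realType) (X : normedModType R).
Variable mu : {finite_measure set T -> \bar R}.
Variables (F : nat -> set (set T)) (tau : T -> T).
Hypothesis hF : forall n, sub_sigma_algebra_of (F n).
Hypothesis Fmono : (forall m n, (m <= n)%N -> F m `<=` F n) \/
  (forall m n, (m <= n)%N -> F n `<=` F m).
Hypothesis htau : measure_preserving mu tau.
Variables (f : T -> X) (Ef : nat -> T -> X).
Hypothesis mf : strongly_measurable measurable f.
Hypothesis hE : forall n, is_cond_exp mu (F n) f (Ef n).

Let a n w := `|Ef n w|.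

Let mEf n : strongly_measurable measurable (Ef n).
Proof. by have [_ []] := hE n. Qed.

Let ma n : measurable_fun [set: T] (a n).
Proof. exact: measurable_norm_strongly_measurable. Qed.

Let Ia n : (\int[mu]_w (a n w)%:E < +oo)%E.
Proof.
have [_ [_ +] _] := hE n; rewrite Lnorm1.
by under eq_integral do rewrite /norm_fun /= normr_id.
Qed.

Let Fgt n l : F n [set w | l < a n w].
Proof.
have [sEf _ _] := hE n; rewrite (sub_sigma_algebraE (hF n)).
apply: (@measurable_gt _ (g_sigma_algebraType (F n))).
apply: (@measurable_norm_strongly_measurable _ (g_sigma_algebraType (F n))).
by rewrite -(sub_sigma_algebraE (hF n)).
Qed.

Let mnf : measurable_fun [set: T] (fun w => `|f w|).
Proof. exact: measurable_norm_strongly_measurable. Qed.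

(** Doob's inequality for the norms [a n], which by the contraction property behave
    like a submartingale dominated by the norm of [f]; for a decreasing sequence
    of sigma-algebras the finite inequality is applied in reversed order. *)
Lemma doob_maximal : weak_maximal mu (fun w => (`|f w|)%:E) (supseq (runmax a)).
Proof.
apply: weak_maximal_supseq => //.
- by move=> w; exact: runmax_nd.
- by move=> K; exact: measurable_runmax.
- exact/measurable_EFinP.
move=> K l l0; case: Fmono => Fm.
  have := @maximal_submartingale_in _ _ _ mu F a (fun w => `|f w|) l K [set: T] hF.
  rewrite setTI; apply=> //.
  - by move=> n; exact: Fm.
  - by move=> n w; exact: normr_ge0.
  - by move=> n A FA; exact: (cond_exp_contraction (hF _) mf (hE _) FA).
  - by rewrite (sub_sigma_algebraE (hF 0)); exact: measurableT.
rewrite -(runmax_rev_gt a K (ltW l0)).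
have := @maximal_submartingale_in _ _ _ mu (fun k => F (K - k.+1)%N)
  (fun k => a (K - k.+1)%N) (fun w => `|f w|) l K [set: T].
rewrite setTI; apply=> //.
- by move=> n; apply: Fm; rewrite leq_sub2l.
- by move=> n w; exact: normr_ge0.
- by move=> n A FA; exact: (cond_exp_contraction (hF _) mf (hE _) FA).
- by rewrite (sub_sigma_algebraE (hF _)); exact: measurableT.
Qed.

(* Averaging the running maxima of the norms, rather than their supremum, keeps
   all functions real-valued. *)
Let emax K := runmax (fun n => birkhoff_avg tau n.+1 (runmax a K)) K.

Let measurable_emax K : measurable_fun [set: T] (emax K).
Proof.
apply: measurable_runmax => n; apply: (measurable_birkhoff_avg htau).
exact: measurable_runmax.
Qed.

Lemma le_birkhoff_avg n (g h : T -> R) w : (forall w, g w <= h w) ->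
  birkhoff_avg tau n g w <= birkhoff_avg tau n h w.
Proof.
by move=> gh; rewrite ler_wpM2l ?invr_ge0//; apply: ler_sum.
Qed.

Lemma le_runmax (b c : nat -> T -> R) K w : (forall k, (k < K)%N -> b k w <= c k w) ->
  runmax b K w <= runmax c K w.
Proof.
elim: K => // K IH bc; rewrite !runmaxS ge_max !le_max IH ?bc ?orbT// => k kK.
by apply: bc; exact: ltnW.
Qed.

Let emax_nd w : nondecreasing_seq (emax ^~ w).
Proof.
apply/nondecreasing_seqP => K; rewrite /emax.
apply: (@le_trans _ _ (runmax (fun n => birkhoff_avg tau n.+1 (runmax a K.+1)) K w)).
  apply: le_runmax => k _; apply: le_birkhoff_avg => x; exact: runmax_nd.
exact: runmax_nd.
Qed.

Lemma ergodic_maximal : weak_maximal mu (supseq (runmax a)) (supseq emax).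
Proof.
have mg : measurable_fun [set: T] (supseq (runmax a)).
  by apply: measurable_supseq => [w|K]; [exact: runmax_nd|exact: measurable_runmax].
have Ig K : (\int[mu]_w (runmax a K w)%:E < +oo)%E.
  elim: K => [|K IH]; first by rewrite integral0_eq.
  apply: (@le_lt_trans _ _ (\int[mu]_w ((runmax a K w)%:E + (a K w)%:E))%E).
    apply: ge0_le_integral => //.
    - by move=> w _; rewrite lee_fin runmax_ge0.
    - by apply/measurable_EFinP; exact: measurable_runmax.
    - by apply: emeasurable_funD; apply/measurable_EFinP => //; exact: measurable_runmax.
    - by move=> w _; rewrite -EFinD lee_fin runmaxS ge_max lerDl lerDr normr_ge0 runmax_ge0.
  rewrite ge0_integralD//.
  - exact: lte_add_pinfty.
  - by move=> w _; rewrite lee_fin runmax_ge0.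
  - by apply/measurable_EFinP; exact: measurable_runmax.
  - by move=> w _; rewrite lee_fin normr_ge0.
  - exact/measurable_EFinP.
apply: weak_maximal_supseq => //.
- move=> w; apply: (le_trans _ (supseq_ge _ 0 w)).
  by rewrite lee_fin runmax_ge0.
move=> K l l0.
apply: (le_trans (@maximal_ergodic _ _ _ mu tau htau (runmax a K) l K _ _ _ _)) => //.
- exact: measurable_runmax.
- by move=> w; exact: runmax_ge0.
apply: ge0_le_integral => //.
- by apply: measurable_gt; exact: measurable_emax.
- by move=> w _; rewrite lee_fin runmax_ge0.
- by apply/measurable_EFinP; apply: measurable_funTS; exact: measurable_runmax.
- exact: measurable_funTS.
- by move=> w _; exact: supseq_ge.
Qed.

(* The double supremum over lengths and indices as a supremum of running maxima
   of finitely many real functions. *)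
Let smax K := runmax (fun n => runmax (fun j w =>
  `|ergodic_average (generated_operator tau) n.+1 (Ef j) w|) K) K.

Lemma iter_generated_operator (Y : Type) i (g : T -> Y) :
  iter i (generated_operator tau) g = g \o iter i tau.
Proof. by elim: i => //= i ->; apply/funext => w /=; rewrite -iterS iterSr. Qed.

Let measurable_smax K : measurable_fun [set: T] (smax K).
Proof.
apply: measurable_runmax => n; apply: measurable_runmax => j.
apply: measurable_norm_strongly_measurable.
apply: strongly_measurableZ; apply: strongly_measurable_sum => i.
rewrite iter_generated_operator.
by apply: (strongly_measurable_comp (measurable_iter htau i)); exact: mEf.
Qed.

Lemma runmax_le b K w (c : R) : 0 <= c -> (forall k, (k < K)%N -> b k w <= c) ->
  @runmax _ T R b K w <= c.
Proof.
move=> c0; elim: K => [//|K IH] bc; rewrite runmaxS ge_max bc// IH// => k kK.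
by apply: bc; exact: ltnW.
Qed.

Let smax_nd w : nondecreasing_seq (smax ^~ w).
Proof.
apply/nondecreasing_seqP => K; rewrite /smax.
apply: (le_trans (le_runmax (c := fun n => runmax (fun j w =>
  `|ergodic_average (generated_operator tau) n.+1 (Ef j) w|) K.+1) _)).
  by move=> k _; exact: runmax_nd.
exact: runmax_nd.
Qed.

Lemma sup_averagesE :
  sup_averages (generated_operator tau) Ef = supseq smax.
Proof.
apply/funext => w; apply/eqP; rewrite eq_le; apply/andP; split.
  apply: ge_ereal_sup => _ [[|n] //= _ [j _ <-]].
  apply: le_trans (supseq_ge smax (maxn n.+1 j.+1) w); rewrite lee_fin.
  apply: (le_trans _ (@runmax_ge _ _ _ _ _ n _ _)); last by rewrite leq_maxl.
  by apply: (runmax_ge _ (k := j)); rewrite leq_maxr.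
apply: ge_ereal_sup => _ [K _ <-].
have S0 : (0 <= sup_averages (generated_operator tau) Ef w)%E.
  apply: (@le_trans _ _ (`|ergodic_average (generated_operator tau) 1 (Ef 0) w|)%:E).
    by rewrite lee_fin.
  by apply: ereal_sup_ubound; exists 1 => //; exists 0.
have SP n j : ((`|ergodic_average (generated_operator tau) n.+1 (Ef j) w|)%:E <=
    sup_averages (generated_operator tau) Ef w)%E.
  by apply: ereal_sup_ubound; exists n.+1 => //; exists j.
case: (sup_averages _ _ w) S0 SP => [r| |]; rewrite ?leey// => r0 SP.
rewrite lee_fin in r0; rewrite lee_fin leNgt; apply/negP.
move=> /(runmax_gtP _ _ _ r0)[n _ /(runmax_gtP _ _ _ r0)[j _ lt]].
by have := SP n j; rewrite lee_fin leNgt lt.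
Qed.

Lemma sup_averages_le w :
  (sup_averages (generated_operator tau) Ef w <= supseq emax w)%E.
Proof.
rewrite sup_averagesE; apply: le_supseq => K.
apply: le_runmax => n nK; apply: runmax_le => [|j jK].
  by rewrite mulr_ge0 ?invr_ge0// sumr_ge0// => i _; exact: runmax_ge0.
rewrite /ergodic_average normrZ ger0_norm ?invr_ge0// ler_wpM2l ?invr_ge0//.
apply: (le_trans (ler_norm_sum _ _ _)); apply: ler_sum => i _.
rewrite iter_generated_operator; exact: (@runmax_ge _ _ _ a K j).
Qed.

Lemma measurable_sup_averages :
  measurable_fun [set: T] (sup_averages (generated_operator tau) Ef).
Proof. by rewrite sup_averagesE; exact: measurable_supseq. Qed.

Lemma sup_averages_ge0 w :
  (0 <= sup_averages (generated_operator tau) Ef w)%E.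
Proof.
by rewrite sup_averagesE; apply: le_trans (supseq_ge _ 0 w); rewrite lee_fin.
Qed.

(** The maximal functions are made real-valued so that the strong inequalities
    apply to them.  [G] is Doob's maximal function, and [H] the maximal function of
    the ergodic averages of [G]; finiteness of the latter almost everywhere comes
    from the integrability of [G], which the two classes of functions [f] provide
    in different ways. *)
Lemma maximal_chain : (\int[mu]_w (`|f w|)%:E < +oo)%E ->
  exists G : T -> R, [/\ measurable_fun [set: T] G, forall w, 0 <= G w,
    weak_maximal mu (fun w => (`|f w|)%:E) (EFin \o G) &
    (\int[mu]_w (G w)%:E < +oo)%E ->
    exists H : T -> R, [/\ measurable_fun [set: T] H, forall w, 0 <= H w,
      weak_maximal mu (EFin \o G) (EFin \o H) &
      {ae mu, forall w,
        sup_averages (generated_operator tau) Ef w <= (H w)%:E}%E]].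
Proof.
move=> If.
have mE : measurable_fun [set: T] (fun w => (`|f w|)%:E) by exact/measurable_EFinP.
set g := supseq (runmax a).
have mg : measurable_fun [set: T] g.
  by apply: measurable_supseq => [w|K]; [exact: runmax_nd|exact: measurable_runmax].
have g0 w : (0 <= g w)%E by apply: le_trans (supseq_ge _ 0 w); rewrite lee_fin.
have mG : measurable_fun [set: T] (fine \o g) by exact: measurableT_comp.
have G0 w : 0 <= (fine \o g) w by rewrite fine_ge0.
have gG := weak_maximal_fin mE mg (fun w => normr_ge0 (f w) : (0 <= (`|f w|)%:E)%E) g0 If doob_maximal.
exists (fine \o g); split => //.
  apply: (weak_maximal_ae mE mg mE _ _ _ _ gG doob_maximal) => //.
  - exact/measurable_EFinP.
  - exact: nearW.
move=> IG.
set h := supseq emax.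
have mh : measurable_fun [set: T] h by exact: measurable_supseq.
have h0 w : (0 <= h w)%E by apply: le_trans (supseq_ge _ 0 w); rewrite lee_fin.
have mEG : measurable_fun [set: T] (EFin \o (fine \o g)) by exact/measurable_EFinP.
have wGh : weak_maximal mu (EFin \o (fine \o g)) h.
  apply: (weak_maximal_ae mg mh mEG mh g0 _ gG _ ergodic_maximal) => //.
  exact: nearW.
have hH := weak_maximal_fin mEG mh G0 h0 IG wGh.
have mH : measurable_fun [set: T] (fine \o h) by exact: measurableT_comp.
exists (fine \o h); split => //.
- by move=> w; rewrite fine_ge0.
- apply: (weak_maximal_ae mEG mh mEG _ _ _ _ hH wGh) => //.
  + exact/measurable_EFinP.
  + exact: nearW.
- by apply: filterS hH => w hw; rewrite /= -hw sup_averages_le.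
Qed.

End assembly.

(** * Integrability and the main theorem *)

Section integrability.
Context d (T : measurableType d) (R : realType).
Variable mu : {finite_measure set T -> \bar R}.

Lemma integral_lty_le_cstD (f h : T -> R) (c : R) :
  measurable_fun [set: T] f -> measurable_fun [set: T] h ->
  (forall w, 0 <= f w) -> (forall w, 0 <= h w) -> 0 <= c ->
  (forall w, f w <= c + h w) ->
  (\int[mu]_w (h w)%:E < +oo -> \int[mu]_w (f w)%:E < +oo)%E.
Proof.
move=> mf mh f0 h0 c0 fh Ih.
apply: (@le_lt_trans _ _ (\int[mu]_w (cst c%:E w + (h w)%:E))%E).
  apply: ge0_le_integral => //.
  - by move=> w _; rewrite lee_fin.
  - exact/measurable_EFinP.
  - by apply: emeasurable_funD => //; exact/measurable_EFinP.
  - by move=> w _; rewrite /= -EFinD lee_fin.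
rewrite ge0_integralD//; last 2 first.
- by move=> w _; rewrite lee_fin.
- exact/measurable_EFinP.
apply: lte_add_pinfty => //; rewrite integral_cst//.
apply: lte_mul_pinfty => //.
by rewrite -ge0_fin_numE// fin_num_mu.
Qed.

Lemma measurable_powRf (p : R) (f : T -> R) : measurable_fun [set: T] f ->
  measurable_fun [set: T] (fun w => f w `^ p).
Proof. by move=> mf; exact: (measurableT_comp (measurable_powR _)). Qed.

Lemma integral_powR_lty (p : R) (f : T -> R) : 1 < p ->
  measurable_fun [set: T] f -> (forall w, 0 <= f w) ->
  (\int[mu]_w (f w `^ p)%:E < +oo -> \int[mu]_w (f w)%:E < +oo)%E.
Proof.
move=> p1 mf f0; apply: (@integral_lty_le_cstD _ _ 1) => //.
- exact: measurable_powRf.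
- by move=> w; rewrite powR_ge0.
- move=> w; have [f1|f1] := leP (f w) 1.
    by apply: (le_trans f1); rewrite lerDl powR_ge0.
  rewrite -[leLHS]powRr1// ler_wpDl// ler_powR ?ltW//.
Qed.

(** The bound on integrals of p-th powers in terms of norms.  [S] is extended
    real-valued, so it is first replaced by its real-valued majorant [H]. *)
Lemma le_Lnorm (p C : R) (S : T -> \bar R) (f H : T -> R) : 0 < p -> 0 <= C ->
  measurable_fun [set: T] S -> measurable_fun [set: T] H ->
  (forall w, 0 <= S w)%E -> (forall w, 0 <= f w) -> (forall w, 0 <= H w) ->
  {ae mu, forall w, (S w <= (H w)%:E)%E} ->
  (\int[mu]_w (H w `^ p)%:E <= (C `^ p)%:E * \int[mu]_w (f w `^ p)%:E)%E ->
  ('N[mu]_p%:E [S] <= C%:E * 'N[mu]_p%:E [EFin \o f])%E.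
Proof.
move=> p0 C0 mS mH S0 f0 H0 SH IH.
have p0' : 0 <= p by exact: ltW.
have ip : p * p^-1 = 1 by rewrite mulfV// gt_eqF.
have IS : (\int[mu]_w (`|S w| `^ p) <= \int[mu]_w (H w `^ p)%:E)%E.
  apply: ae_ge0_le_integral => //.
  - by move=> w _; exact: poweR_ge0.
  - apply: (measurableT_comp (measurable_poweR _)).
    exact: measurableT_comp.
  - by move=> w _; rewrite lee_fin powR_ge0.
  - by apply/measurable_EFinP; exact: measurable_powRf.
  - apply: filterS SH => w SHw _; rewrite gee0_abs// -poweR_EFin.
    by apply: gt0_ler_poweR; rewrite // in_itv/= ?lee_fin leey andbT.
rewrite unlock /=; under [in leRHS]eq_integral do rewrite ger0_norm//.
set I := (\int[mu]_w (f w `^ p)%:E)%E in IH *.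
have I0 : (0 <= I)%E by apply: integral_ge0 => w _; rewrite lee_fin powR_ge0.
have CI0 : (0 <= (C `^ p)%:E * I)%E by rewrite mule_ge0// lee_fin powR_ge0.
apply: (@le_trans _ _ (((C `^ p)%:E * I) `^ p^-1)%E).
  apply: gt0_ler_poweR; rewrite ?invr_ge0 ?in_itv/= ?leey ?andbT//.
    by apply: integral_ge0 => w _; exact: poweR_ge0.
  exact: le_trans IH.
by rewrite poweRM ?lee_fin ?powR_ge0// poweR_EFin -powRrM ip powRr1.
Qed.

Lemma measurable_LlogL (k : nat) (f : T -> R) : measurable_fun [set: T] f ->
  measurable_fun [set: T] (fun w => f w * ln (Num.max 1 (f w)) ^+ k).
Proof. by move=> mf; apply: measurable_funM => //; exact: measurable_lnmax1X. Qed.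

Lemma integral_LlogL_lty (k : nat) (f : T -> R) :
  measurable_fun [set: T] f -> (forall w, 0 <= f w) ->
  (\int[mu]_w (f w * ln (Num.max 1 (f w)) ^+ k)%:E < +oo ->
   \int[mu]_w (f w)%:E < +oo)%E.
Proof.
move=> mf f0; apply: (@integral_lty_le_cstD _ _ (expR 1)) => //.
- exact: measurable_LlogL.
- by move=> w; rewrite mulr_ge0 ?exprn_ge0 ?lnmax1_ge0.
- by move=> w; exact: le_LlogL.
Qed.

End integrability.

Theorem theorem3p4 (R : realType) (X : completeNormedModType R)
    (hX : reflexive_space X)
    (d : measure_display) (Omega : measurableType d)
    (mu : {finite_measure set Omega -> \bar R})
    (F : nat -> set (set Omega)) (Finf : set (set Omega))
    (hF : forall n, sub_sigma_algebra_of (F n))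
    (hFinf : monotone_sigma_algebras F Finf)
    (tau : Omega -> Omega) (htau : measure_preserving mu tau) :
  (forall (p : R) (f : Omega -> X) (Ef : nat -> Omega -> X),
     1 < p ->
     Lp_space mu p f ->
     (forall n, is_cond_exp mu (F n) f (Ef n)) ->
     mu.-integrable [set: Omega]
       (fun w => ereal_sup (range (fun n => (`|Ef n w|)%:E))) ->
     ('N[mu]_p%:E [sup_averages (generated_operator tau) Ef]
       <= ((p / (p - 1)) ^+ 2)%:E * 'N[mu]_p%:E [norm_fun f])%E) /\
  (forall (m : nat) (f : Omega -> X) (Ef : nat -> Omega -> X),
     LlogL_space mu m.+2 f ->
     (forall n, is_cond_exp mu (F n) f (Ef n)) ->
     exists2 h : Omega -> R^o, LlogL_space mu m h &
       {ae mu, forall w,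
         sup_averages (generated_operator tau) Ef w = (h w)%:E}).
Proof.
have Fmono : (forall m n, (m <= n)%N -> F m `<=` F n) \/
    (forall m n, (m <= n)%N -> F n `<=` F m).
  by case: hFinf => -[H _]; [left|right].
split.
  move=> p f Ef p1 [mf Nf] hE _.
  have p0 : 0 < p by apply: lt_trans p1.
  have q0 : 0 < p / (p - 1) by rewrite divr_gt0// subr_gt0.
  have strong (g h : Omega -> R) := @strong_maximal_Lp _ _ _ mu p g h p1.
  move: (p / (p - 1)) q0 strong => q q0 strong.
  have mnf : measurable_fun [set: Omega] (fun w => `|f w|).
    exact: measurable_norm_strongly_measurable.
  set I := (\int[mu]_w (`|f w| `^ p)%:E)%E.
  have IE : (\int[mu]_w (`|norm_fun f w| `^ p) = I)%E.
    by apply: eq_integral => w _; rewrite /norm_fun /= normr_id.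
  have Ifin : (I < +oo)%E.
    move: Nf; rewrite unlock /= IE; apply: lty_poweRy.
    by rewrite invr_eq0 gt_eqF.
  have [|G [mG G0 wG]] := maximal_chain hF Fmono htau mf hE.
    exact: (integral_powR_lty p1).
  have IG : (\int[mu]_w (G w `^ p)%:E <= (q `^ p)%:E * I)%E.
    by apply: (strong (fun w => `|f w|)).
  have IG1 : (\int[mu]_w (G w)%:E < +oo)%E.
    apply: (integral_powR_lty p1 mG G0).
    by apply: (le_lt_trans IG); apply: lte_mul_pinfty; rewrite ?lee_fin ?powR_ge0.
  move=> /(_ IG1)[H [mH H0 wH SH]].
  have IH : (\int[mu]_w (H w `^ p)%:E <= (q `^ p)%:E * ((q `^ p)%:E * I))%E.
    apply: (le_trans (strong _ _ mG mH G0 H0 wH)).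
    by apply: lee_wpmul2l; rewrite ?lee_fin ?powR_ge0.
  have q20 : 0 <= q ^+ 2 by rewrite exprn_ge0// ltW.
  apply: (le_Lnorm p0 q20 (measurable_sup_averages htau hE) mH
    (sup_averages_ge0 _ _) (fun w => normr_ge0 (f w)) H0 SH).
  rewrite expr2 (powRM _ (ltW q0) (ltW q0)) EFinM -muleA; exact: IH.
move=> m f Ef [mf If] hE.
have mnf : measurable_fun [set: Omega] (fun w => `|f w|).
  exact: measurable_norm_strongly_measurable.
have [|G [mG G0 wG]] := maximal_chain hF Fmono htau mf hE.
  exact: (integral_LlogL_lty (k := m.+2)).
have IG := LlogL_maximal mnf mG (fun w => normr_ge0 (f w)) G0 wG If.
move=> []; first exact: (integral_LlogL_lty (k := m.+1)).
move=> H [mH H0 wH SH].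
have IH := LlogL_maximal mG mH G0 H0 wH IG.
set S := sup_averages _ _ in SH *.
have S0 w : (0 <= S w)%E by exact: sup_averages_ge0.
have mS : measurable_fun [set: Omega] S by exact: (measurable_sup_averages htau hE).
have mh : measurable_fun [set: Omega] (fine \o S) by exact: measurableT_comp.
have h0 w : 0 <= fine (S w) by rewrite fine_ge0.
have Sh : {ae mu, forall w, S w = (fine (S w))%:E}.
  apply: filterS SH => w SHw; rewrite fineK// ge0_fin_numE//.
  by apply: (le_lt_trans SHw); rewrite ltry.
exists (fine \o S); last exact: Sh.
split; first exact: strongly_measurable_real.
under eq_integral do rewrite /= ger0_norm//.
apply: le_lt_trans IH; apply: ae_ge0_le_integral => //.
- by move=> w _; rewrite lee_fin mulr_ge0 ?exprn_ge0 ?lnmax1_ge0.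
- by apply/measurable_EFinP; exact: (measurable_LlogL _ mh).
- by move=> w _; rewrite lee_fin mulr_ge0 ?exprn_ge0 ?lnmax1_ge0.
- by apply/measurable_EFinP; exact: measurable_LlogL.
apply: filterS2 SH Sh => w SHw Shw _; rewrite Shw lee_fin in SHw.
rewrite lee_fin ler_pM ?exprn_ge0 ?lnmax1_ge0//.
rewrite lerXn2r ?nnegrE ?lnmax1_ge0//.
rewrite ler_ln ?posrE ?lt_max ?ltr01//.
by rewrite ge_max !le_max lexx SHw orbT.
Qed.
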